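(* Let $\varepsilon>0$ be a constant. Given a set $P$ of $n$ points in the plane, a vertex cover $V^*$ of the unit disk graph of $P$ with $|V^*|\le(1+\varepsilon)|\mathit{OPT}|$, where $\mathit{OPT}$ is a minimum vertex cover, can be computed in $O(n)$ time on the real-RAM with constant-time hashing and the floor function. Without these operations, it can be done in $O(n\log n)$ time.
   Context: The unit disk graph of $P\subset\mathbb{R}^2$ has vertex set $P$, two points adjacent iff their Euclidean distance is at most $2$. A vertex cover is a set of vertices meeting every edge. *)

(* Defs.v *)
From HB Require Import structures.
From mathcomp Require Import all_boot all_order all_algebra.
From mathcomp Require Import finmap.
From mathcomp Require Import reals.

Set Implicit Arguments.
Unset Strict Implicit.
Unset Printing Implicit Defensive.

Import Order.TTheory GRing.Theory Num.Theory.
Local Open Scope fset_scope.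
Local Open Scope ring_scope.

Definition point (R : realType) : choiceType := (R * R)%type.

Section UnitDiskGraph.
Variable R : realType.
Implicit Types (p q : point R) (P V W : {fset point R}).

Definition dist p q : R :=
  Num.sqrt ((p.1 - q.1) ^+ 2 + (p.2 - q.2) ^+ 2).

Definition adjacent p q : bool := (p != q) && (dist p q <= 2).

Definition vertex_cover P V : Prop :=
  V `<=` P /\
  forall p q, p \in P -> q \in P -> adjacent p q -> p \in V \/ q \in V.

Definition min_vertex_cover P V : Prop :=
  vertex_cover P V /\
  forall W, vertex_cover P W -> (#|` V| <= #|` W|)%N.

End UnitDiskGraph.

(* A program of the real RAM is a fixed finite term.  It manipulates integer and real
   registers, integer and real arrays, and hash tables, all named by natural
   numbers.  Its only constants are integers: arbitrary real constants could
   encode infinite tables of advice.  There is no conversion from reals to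
   integers other than the instruction [Floor]. *)

Inductive iexp : Type :=
| IConst of int
| IReg of nat
| IAdd of iexp & iexp
| ISub of iexp & iexp
| IMul of iexp & iexp.

Inductive rexp : Type :=
| ROfInt of iexp
| RReg of nat
| RAdd of rexp & rexp
| RSub of rexp & rexp
| RMul of rexp & rexp
| RDiv of rexp & rexp.

Inductive bexp : Type :=
| BLeI of iexp & iexp
| BLeR of rexp & rexp
| BNot of bexp
| BAnd of bexp & bexp.

(* In [ILoad x a e], [x] is the target register, [a] the name of the array
   and [e] the address; in [IStore a e v], [v] is the value written.  Keys of
   hash tables are pairs of arbitrary integers. *)
Inductive instr : Type :=
| ISet of nat & iexp
| RSet of nat & rexp
| ILoad of nat & nat & iexp
| IStore of nat & iexp & iexp
| RLoad of nat & nat & iexp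
| RStore of nat & iexp & rexp
| Floor of nat & rexp
| HLoad of nat & nat & iexp & iexp
| HStore of nat & iexp & iexp & iexp.

Inductive program : Type :=
| Skip
| Instr of instr
| Seq of program & program
| If of bexp & program & program
| While of bexp & program.

(* Programs of the real RAM without the floor function and without hashing. *)
Definition plain_instr (i : instr) : bool :=
  match i with
  | Floor _ _ | HLoad _ _ _ _ | HStore _ _ _ _ => false
  | _ => true
  end.

Fixpoint plain (c : program) : bool :=
  match c with
  | Skip => true
  | Instr i => plain_instr i
  | Seq c1 c2 | If _ c1 c2 => plain c1 && plain c2
  | While _ c1 => plain c1
  end.

Section Semantics.
Variable R : realType.

(* Arrays are keyed by (name, address), hash tables by (name, (key, key)). *)
Record state : Type := State {
  ireg : nat -> int;
  rreg : nat -> R;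
  iarr : nat * nat -> int;
  rarr : nat * nat -> R;
  htab : nat * (int * int) -> int
}.

Fixpoint ieval (st : state) (e : iexp) : int :=
  match e with
  | IConst z => z
  | IReg x => ireg st x
  | IAdd e1 e2 => ieval st e1 + ieval st e2
  | ISub e1 e2 => ieval st e1 - ieval st e2
  | IMul e1 e2 => ieval st e1 * ieval st e2
  end.

(* Division by zero follows the library convention x / 0 = 0. *)
Fixpoint reval (st : state) (e : rexp) : R :=
  match e with
  | ROfInt e1 => (ieval st e1)%:~R
  | RReg x => rreg st x
  | RAdd e1 e2 => reval st e1 + reval st e2
  | RSub e1 e2 => reval st e1 - reval st e2
  | RMul e1 e2 => reval st e1 * reval st e2
  | RDiv e1 e2 => reval st e1 / reval st e2
  end.

Fixpoint beval (st : state) (b : bexp) : bool :=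
  match b with
  | BLeI e1 e2 => ieval st e1 <= ieval st e2
  | BLeR e1 e2 => reval st e1 <= reval st e2
  | BNot b1 => ~~ beval st b1
  | BAnd b1 b2 => beval st b1 && beval st b2
  end.

(* Addresses must lie in [0, N), where N is the amount of memory per array;
   any other access is an error.  Hence the keys of a hash table, which are
   unbounded, cannot be simulated by using them directly as addresses. *)
Definition address (N : nat) (z : int) : option nat :=
  match z with
  | Posz i => if (i < N)%N then Some i else None
  | Negz _ => None
  end.

Definition set_ireg st x v :=
  State [eta ireg st with x |-> v] (rreg st) (iarr st) (rarr st) (htab st).
Definition set_rreg st x v :=
  State (ireg st) [eta rreg st with x |-> v] (iarr st) (rarr st) (htab st).
Definition set_iarr st k v :=
  State (ireg st) (rreg st) [eta iarr st with k |-> v] (rarr st) (htab st).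
Definition set_rarr st k v :=
  State (ireg st) (rreg st) (iarr st) [eta rarr st with k |-> v] (htab st).
Definition set_htab st k v :=
  State (ireg st) (rreg st) (iarr st) (rarr st) [eta htab st with k |-> v].

Definition step (N : nat) (i : instr) (st : state) : option state :=
  match i with
  | ISet x e => Some (set_ireg st x (ieval st e))
  | RSet x e => Some (set_rreg st x (reval st e))
  | ILoad x a e =>
      omap (fun j => set_ireg st x (iarr st (a, j))) (address N (ieval st e))
  | IStore a e v =>
      omap (fun j => set_iarr st (a, j) (ieval st v)) (address N (ieval st e))
  | RLoad x a e =>
      omap (fun j => set_rreg st x (rarr st (a, j))) (address N (ieval st e))
  | RStore a e v =>
      omap (fun j => set_rarr st (a, j) (reval st v)) (address N (ieval st e))
  | Floor x e => Some (set_ireg st x (Num.floor (reval st e)))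
  | HLoad x h k l =>
      Some (set_ireg st x (htab st (h, (ieval st k, ieval st l))))
  | HStore h k l v =>
      Some (set_htab st (h, (ieval st k, ieval st l)) (ieval st v))
  end.

(* [exec N c st t st']: with N cells per array, [c] started in [st] halts in
   [st'] after [t] time units.  Instructions and tests take unit time; since
   the expressions of a fixed program have bounded size, this agrees up to a
   constant factor with charging every arithmetic operation separately. *)
Inductive exec (N : nat) : program -> state -> nat -> state -> Prop :=
| exec_skip st : exec N Skip st 1 st
| exec_instr i st st' :
    step N i st = Some st' -> exec N (Instr i) st 1 st'
| exec_seq c1 c2 st st1 st2 t1 t2 :
    exec N c1 st t1 st1 -> exec N c2 st1 t2 st2 ->
    exec N (Seq c1 c2) st (t1 + t2)%N st2
| exec_if b c1 c2 st st' t :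
    exec N (if beval st b then c1 else c2) st t st' ->
    exec N (If b c1 c2) st t.+1 st'
| exec_while_stop b c st :
    ~~ beval st b -> exec N (While b c) st 1 st
| exec_while_loop b c st st1 st2 t1 t2 :
    beval st b -> exec N c st t1 st1 -> exec N (While b c) st1 t2 st2 ->
    exec N (While b c) st (t1 + t2).+1 st2.

(* The input points are listed in the real arrays 0 (abscissas) and 1
   (ordinates), and integer register 0 holds their number.  All other cells
   are 0 and all hash tables are empty; looking up an absent key yields 0. *)
Definition init (s : seq (point R)) : state :=
  State (fun x => if x == 0%N then (size s)%:Z else 0)
        (fun=> 0)
        (fun=> 0)
        (fun k => if k.1 == 0%N then (nth (0, 0) s k.2).1
                  else if k.1 == 1%N then (nth (0, 0) s k.2).2 else 0)
        (fun=> 0).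

(* The output is the set of points marked nonzero in integer array 0. *)
Definition output (s : seq (point R)) (st : state) : {fset point R} :=
  [fset p in s | iarr st (0%N, index p s) != 0].

(* [c] halts on input [s] within [N] time units, using at most [N] cells of
   each array, in state [st]. *)
Definition halts_within (N : nat) (c : program) (s : seq (point R))
    (st : state) : Prop :=
  exists2 t : nat, (t <= N)%N & exec N c (init s) t st.

(* [c] computes, within time [T n] on every set of [n] points, presented in
   any order, a vertex cover of size at most (1 + eps) times the optimum. *)
Definition approximates_vertex_cover (eps : R) (c : program)
    (T : nat -> nat) : Prop :=
  forall (P : {fset point R}) (s : seq (point R)), perm_eq s P ->
  exists2 st : state, halts_within (T #|` P|) c s st &
    vertex_cover P (output s st) /\
    forall OPT : {fset point R}, min_vertex_cover P OPT ->
      #|` output s st|%:R <= (1 + eps) * #|` OPT|%:R.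

End Semantics.

Definition bigO (T f : nat -> nat) : Prop :=
  exists C n0 : nat, forall n : nat, (n0 <= n)%N -> (T n <= C * f n)%N.

(* Main.v *)
Require Import Defs.
From mathcomp Require Import all_boot all_order all_algebra.
From mathcomp Require Import finmap.
From mathcomp Require Import reals.
From mathcomp Require Import zify ring lra.

Set Implicit Arguments.
Unset Strict Implicit.
Unset Printing Implicit Defensive.

Import Order.TTheory GRing.Theory Num.Theory.
Local Open Scope ring_scope.

(* Round the points to cells of side 1, so that the points of a cell are pairwise adjacent
   and adjacent points lie in cells at distance at most 2.  For each of [k] diagonal shifts,
   cut the plane into blocks of [k] by [k] cells, each enlarged by two cells so that every
   edge lies in some block.  A block of [m] points has at most [(k + 2) ^ 2] points outside
   any vertex cover, so if [m] is large all its points can be taken; otherwise an optimal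
   cover of the block is found by exhaustive search in constant time.  The union over the
   blocks costs about the sum over the blocks of the part of OPT they contain; since a point
   is in more than one block for at most 4 of the [k] shifts (and then in at most 4 blocks),
   this is at most [(1 + 12 / k) |OPT|] on average over the shifts, and the best shift is
   kept.

   Blocks get consecutive integer names by floor and hashing.  Without these operations,
   a coordinate is rounded by scanning the points in increasing order and opening a new
   cell when a point lies more than 1 beyond the first point of the current cell; the pairs
   of block coordinates are named by the same procedure with threshold 0.  The sorted scan
   extracts minima from a tournament tree. *)

(** * Program logic *)

Section Logic.
Variables (R : realType) (N : nat).
Implicit Types (st : state R) (c : program) (Q : state R -> Prop).

(** The ratio is a product of two factors [(K + 1) / K]. One is the loss on large blocks: if a block
    has at least [K + 1] times as many points as can lie outside a cover, the cover contains a
    fraction [K / (K + 1)] of it. The other is the average overlap of the blocks, with [k = 12 K].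
    Since [(K + 1) ^ 2 <= K ^ 2 + 3 K], any [K >= 3 / eps] will do. A program is a fixed term, so
    [K], [k] and the size threshold are compiled into it. Work of constant size is unrolled into
    loop-free code, whose time is bounded by its syntax alone; only the loops over points or table
    cells and the climbs in the tree need a count of rounds. The two machines differ only in the
    production of cells and block names; everything else relies on the interface [identified]. The
    sorted scan satisfies it although it numbers cells consecutively and thereby drops empty
    stretches of the line: this can only bring cell numbers closer together, and no lower bound on
    them is required. *)

Definition wp c (T : nat) Q st : Prop :=
  exists t st', [/\ exec N c st t st', (t <= T)%N & Q st'].

Lemma wp_weaken c T T' Q Q' st :
  wp c T Q st -> (T <= T')%N -> (forall st', Q st' -> Q' st') -> wp c T' Q' st.
Proof.
move=> [t [st' [e le q]]] leT QQ; exists t, st'; split=> //; last exact: QQ.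
exact: leq_trans leT.
Qed.

Lemma wp_skip Q st : Q st -> wp Skip 1 Q st.
Proof. by exists 1%N, st; split=> //; constructor. Qed.

Lemma wp_seq c1 c2 T1 T2 Q st :
  wp c1 T1 (wp c2 T2 Q) st -> wp (Seq c1 c2) (T1 + T2) Q st.
Proof.
move=> [t1 [s1 [e1 l1 [t2 [s2 [e2 l2 q]]]]]]; exists (t1 + t2)%N, s2.
by split=> //; [apply: exec_seq e2 | exact: leq_add].
Qed.

Lemma wp_step i st st' Q : step N i st = Some st' -> Q st' -> wp (Instr i) 1 Q st.
Proof. by exists 1%N, st'; split=> //; constructor. Qed.

Lemma wp_iset x e Q st : Q (set_ireg st x (ieval st e)) -> wp (Instr (ISet x e)) 1 Q st.
Proof. exact: wp_step. Qed.

Lemma wp_rset x e Q st : Q (set_rreg st x (reval st e)) -> wp (Instr (RSet x e)) 1 Q st.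
Proof. exact: wp_step. Qed.

Lemma wp_floor x e Q st :
  Q (set_ireg st x (Num.floor (reval st e))) -> wp (Instr (Floor x e)) 1 Q st.
Proof. exact: wp_step. Qed.

Lemma wp_hload x h e f Q st :
  Q (set_ireg st x (htab st (h, (ieval st e, ieval st f)))) ->
  wp (Instr (HLoad x h e f)) 1 Q st.
Proof. exact: wp_step. Qed.

Lemma wp_hstore h e f v Q st :
  Q (set_htab st (h, (ieval st e, ieval st f)) (ieval st v)) ->
  wp (Instr (HStore h e f v)) 1 Q st.
Proof. exact: wp_step. Qed.

Lemma wp_iload j x a e Q st : ieval st e = j%:Z -> (j < N)%N ->
  Q (set_ireg st x (iarr st (a, j))) -> wp (Instr (ILoad x a e)) 1 Q st.
Proof. by move=> E lt; apply: wp_step; rewrite /= E /= lt. Qed.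

Lemma wp_istore j a e v Q st : ieval st e = j%:Z -> (j < N)%N ->
  Q (set_iarr st (a, j) (ieval st v)) -> wp (Instr (IStore a e v)) 1 Q st.
Proof. by move=> E lt; apply: wp_step; rewrite /= E /= lt. Qed.

Lemma wp_rload j x a e Q st : ieval st e = j%:Z -> (j < N)%N ->
  Q (set_rreg st x (rarr st (a, j))) -> wp (Instr (RLoad x a e)) 1 Q st.
Proof. by move=> E lt; apply: wp_step; rewrite /= E /= lt. Qed.

Lemma wp_rstore j a e v Q st : ieval st e = j%:Z -> (j < N)%N ->
  Q (set_rarr st (a, j) (reval st v)) -> wp (Instr (RStore a e v)) 1 Q st.
Proof. by move=> E lt; apply: wp_step; rewrite /= E /= lt. Qed.

Lemma wp_if b c1 c2 T1 T2 Q st :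
  (beval st b -> wp c1 T1 Q st) -> (~~ beval st b -> wp c2 T2 Q st) ->
  wp (If b c1 c2) (maxn T1 T2).+1 Q st.
Proof.
move=> w1 w2; case E: (beval st b).
- have [t [st' [e l q]]] := w1 E; exists t.+1, st'; split=> //.
    by constructor; rewrite E.
  by rewrite ltnS leq_max l.
- have [t [st' [e l q]]] := w2 (negbT E); exists t.+1, st'; split=> //.
    by constructor; rewrite E.
  by rewrite ltnS leq_max l orbT.
Qed.

Lemma wp_while_stop b c Q st : ~~ beval st b -> Q st -> wp (While b c) 1 Q st.
Proof. by exists 1%N, st; split=> //; constructor. Qed.

Lemma wp_while_loop b c T1 T2 Q st : beval st b ->
  wp c T1 (wp (While b c) T2 Q) st -> wp (While b c) (T1 + T2).+1 Q st.
Proof.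
move=> B [t1 [s1 [e1 l1 [t2 [s2 [e2 l2 q]]]]]]; exists (t1 + t2).+1, s2.
by split=> //; [apply: exec_while_loop e2 | rewrite ltnS leq_add].
Qed.

Definition for_loop (x : nat) (e : iexp) c : program :=
  Seq (Instr (ISet x (IConst 0)))
      (While (BLeI (IAdd (IReg x) (IConst 1)) e)
             (Seq c (Instr (ISet x (IAdd (IReg x) (IConst 1)))))).

(** The bound [e] is evaluated anew at every test, so the invariant has to guarantee that the test
    means [i < n]. A round costs the body, one test and one increment; the initialisation and the
    last test are paid by the extra round. *)
Lemma wp_for (I : nat -> state R -> Prop) (n T : nat) x e c Q st :
  (forall i st1, I i st1 -> (i <= n)%N -> ireg st1 x = i%:Z ->
     (i%:Z + 1 <= ieval st1 e) = (i < n)%N) ->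
  I 0%N (set_ireg st x 0) ->
  (forall i st1, I i st1 -> (i < n)%N -> ireg st1 x = i%:Z ->
     wp c T (fun st2 => ireg st2 x = i%:Z /\ I i.+1 (set_ireg st2 x i.+1%:Z)) st1) ->
  (forall st1, I n st1 -> ireg st1 x = n%:Z -> Q st1) ->
  wp (for_loop x e c) (T.+2 * n.+1) Q st.
Proof.
move=> hb h0 hs hq.
have loop d i st1 : (i + d = n)%N -> I i st1 -> ireg st1 x = i%:Z ->
    wp (While (BLeI (IAdd (IReg x) (IConst 1)) e)
         (Seq c (Instr (ISet x (IAdd (IReg x) (IConst 1)))))) (T.+2 * d + 1) Q st1.
  elim: d i st1 => [|d IH] i st1 E Hi Hx.
    have Ei : i = n by lia.
    rewrite muln0; apply: wp_while_stop; last by apply: hq; rewrite -?Ei.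
    by rewrite /= Hx (hb i) // ?Ei ?ltnn.
  apply: (@wp_weaken _ ((T + 1) + (T.+2 * d + 1)).+1 _ Q); [|lia|by []].
  have lt : (i < n)%N by lia.
  apply: wp_while_loop; first by rewrite /= Hx (hb i) ?(ltnW lt) ?lt.
  apply: wp_seq; apply: wp_weaken (hs i st1 Hi lt Hx) _ _ => // st2 [Ex Hi2].
  apply: wp_iset => /=; rewrite Ex; apply: (IH i.+1); [lia| |].
    by rewrite [(_ + 1)%R](_ : _ = i.+1%:Z); last lia.
  by rewrite /= eqxx; lia.
apply: (@wp_weaken _ (1 + (T.+2 * n + 1)) _ Q); [|lia|by []].
by apply: wp_seq; apply: wp_iset; apply: (loop n 0%N) => //=; rewrite eqxx.
Qed.

Fixpoint loop_free c : bool :=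
  match c with
  | Skip | Instr _ => true
  | Seq c1 c2 | If _ c1 c2 => loop_free c1 && loop_free c2
  | While _ _ => false
  end.

(** Meaningful for loop-free code only. Both branches of a conditional are added, a crude bound that
    is harmless for code of constant size. *)
Fixpoint ticks c : nat :=
  match c with
  | Seq c1 c2 => (ticks c1 + ticks c2)%N
  | If _ c1 c2 => (ticks c1 + ticks c2).+1%N
  | _ => 1
  end.

Lemma exec_ticks c st t st' : exec N c st t st' -> loop_free c -> (t <= ticks c)%N.
Proof.
elim=> {c st t st'} //= [c1 c2 st st1 st2 t1 t2 _ IH1 _ IH2|b c1 c2 st st' t _].
  by case/andP=> /IH1 l1 /IH2; exact: leq_add.
move=> IH /andP[lf1 lf2]; rewrite ltnS; case: (beval st b) IH => IH.
  by apply: leq_trans (IH lf1) _; exact: leq_addr.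
by apply: leq_trans (IH lf2) _; exact: leq_addl.
Qed.

(** The given [T] is discarded: for loop-free code any derivation of the postcondition yields the
    syntactic bound, so later proofs about such code need not keep time. *)
Lemma wp_ticks c T Q st : loop_free c -> wp c T Q st -> wp c (ticks c) Q st.
Proof.
by move=> lf [t [st' [e _ q]]]; exists t, st'; split=> //; apply: exec_ticks e lf.
Qed.

Fixpoint seqs (l : seq program) : program :=
  if l is c :: l' then Seq c (seqs l') else Skip.

(** Macro expansion: [m] is a constant of the program and [i] a literal in [f i], so the copies may
    name different registers, which a loop cannot do. *)
Definition unroll (m : nat) (f : nat -> program) : program := seqs (map f (iota 0 m)).

Lemma wp_unroll (I : nat -> state R -> Prop) m f (T : nat -> nat) st :
  I 0%N st -> (forall i st1, (i < m)%N -> I i st1 -> wp (f i) (T i) (I i.+1) st1) ->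
  wp (unroll m f) (\sum_(i <- iota 0 m) T i + 1) (I m) st.
Proof.
rewrite /unroll => h0 hs.
have gen d i st1 : (i + d = m)%N -> I i st1 ->
    wp (seqs (map f (iota i d))) (\sum_(j <- iota i d) T j + 1) (I m) st1.
  elim: d i st1 => [|d IH] i st1 E Hi /=.
    by rewrite big_nil; apply: wp_skip; rewrite -E addn0.
  rewrite big_cons -addnA.
  apply: wp_seq; apply: wp_weaken (hs i st1 _ Hi) (leqnn _) _; first lia.
  by move=> st2 H2; apply: IH H2; lia.
exact: gen.
Qed.

(** A [find] over a list known at compile time, as nested conditionals. *)
Fixpoint chain (A : Type) (b : A -> bexp) (f : A -> program) (l : seq A) : program :=
  if l is a :: l' then If (b a) (f a) (chain b f l') else Skip.

Lemma wp_chain (A : Type) a0 (b : A -> bexp) f l T Q st :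
  let p a := beval st (b a) in
  has p l -> wp (f (nth a0 l (find p l))) T Q st -> wp (chain b f l) (T + size l) Q st.
Proof.
move=> p; elim: l => //= a l IH; rewrite addnS.
case E: (p a) => /= hl w.
  apply: (@wp_weaken _ (maxn T 0).+1 _ Q); [|lia|by []].
  by apply: wp_if => // /negP[].
apply: (@wp_weaken _ (maxn 0 (T + size l)).+1 _ Q); [|lia|by []].
by apply: wp_if; rewrite -/(p a) E // => _; apply: IH.
Qed.

End Logic.

Arguments wp_weaken {R N c T T' Q Q' st}.

(** * Syntactic write sets and the frame rule *)

Definition writes_ireg_instr i x := match i with
  | ISet y _ | ILoad y _ _ | Floor y _ | HLoad y _ _ _ => x == y | _ => false end.
Definition writes_rreg_instr i x := match i with
  | RSet y _ | RLoad y _ _ => x == y | _ => false end.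
Definition writes_iarr_instr i x := match i with IStore y _ _ => x == y | _ => false end.
Definition writes_rarr_instr i x := match i with RStore y _ _ => x == y | _ => false end.

Fixpoint writes (w : instr -> nat -> bool) (c : program) (x : nat) : bool :=
  match c with
  | Skip => false
  | Instr i => w i x
  | Seq c1 c2 | If _ c1 c2 => writes w c1 x || writes w c2 x
  | While _ c1 => writes w c1 x
  end.
Notation writes_ireg := (writes writes_ireg_instr).
Notation writes_rreg := (writes writes_rreg_instr).
Notation writes_iarr := (writes writes_iarr_instr).
Notation writes_rarr := (writes writes_rarr_instr).

Lemma writes_seqs w l x : writes w (seqs l) x = has (fun c => writes w c x) l.
Proof. by elim: l => //= c l ->. Qed.

Lemma writes_unroll w m f x :
  writes w (unroll m f) x = has (fun i => writes w (f i) x) (iota 0 m).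
Proof. by rewrite /unroll writes_seqs has_map. Qed.

Section Frame.
Variables (R : realType) (N : nat).
Implicit Types (st : state R).

Record frame c st st' : Prop := Frame {
  frame_ireg x : ~~ writes_ireg c x -> ireg st' x = ireg st x;
  frame_rreg x : ~~ writes_rreg c x -> rreg st' x = rreg st x;
  frame_iarr a j : ~~ writes_iarr c a -> iarr st' (a, j) = iarr st (a, j);
  frame_rarr a j : ~~ writes_rarr c a -> rarr st' (a, j) = rarr st (a, j) }.

Lemma exec_frame c st t st' : exec N c st t st' -> frame c st st'.
Proof.
elim=> {c st t st'} [st|i st st'|c1 c2 st s1 s2 t1 t2 _ [i1 r1 ia1 ra1] _ [i2 r2 ia2 ra2]|b c1 c2 st st' t _|b c st _|b c st s1 s2 t1 t2 _ _ [i1 r1 ia1 ra1] _ [i2 r2 ia2 ra2]].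
- by [].
- case: i => /= [x e [<-]|x e [<-]|x a e|a e v|x a e|a e v|x e [<-]|x h k l [<-]|h k l v [<-]];
    try (case: address => //= j [<-]); split=> //= y; try (by move=> /negbTE->);
    by move=> z /negbTE y_x; rewrite xpair_eqE y_x.
- by split=> x; [| |move=> j|move=> j]; rewrite negb_or => /andP[h1 h2];
    rewrite ?i2 ?i1 ?r2 ?r1 ?ia2 ?ia1 ?ra2 ?ra1.
- case: (beval st b) => -[i1 r1 ia1 ra1]; split=> x; [| |move=> j|move=> j| | |move=> j|move=> j];
  by rewrite negb_or => /andP[h1 h2]; rewrite ?i1 ?r1 ?ia1 ?ra1.
- by [].
- by split=> x; [| |move=> j|move=> j] => h1;
    rewrite ?i2 ?i1 ?r2 ?r1 ?ia2 ?ia1 ?ra2 ?ra1.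
Qed.

(** The frame is available while the postcondition is proved, so specifications mention only what a
    program changes; the rest is read off its syntax. *)
Lemma wp_frame c T Q st :
  wp N c T (fun st' => frame c st st' -> Q st') st -> wp N c T Q st.
Proof.
move=> [t [st' [e l q]]]; exists t, st'; split=> //.
by apply: q; apply: exec_frame e.
Qed.

End Frame.

(** * Tournament trees and one-dimensional clustering *)

(* Node [u] of the tree has the children [2 u] and [2 u + 1], the leaf of index [i] is
   node [m + i] with [m] in register 1, and an entry -1 stands for an empty subtree.  Node 0
   is a harmless extra node.  Lacking integer division, array 2 tabulates the parents. *)
Definition tree_node (ka : nat) : program :=
  Seq (Instr (ILoad 4 1 (IMul (IConst 2) (IReg 3))))
  (Seq (Instr (ILoad 5 1 (IAdd (IMul (IConst 2) (IReg 3)) (IConst 1))))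
  (If (BLeI (IReg 4) (IConst (-1))) (Instr (IStore 1 (IReg 3) (IReg 5)))
  (If (BLeI (IReg 5) (IConst (-1))) (Instr (IStore 1 (IReg 3) (IReg 4)))
  (Seq (Instr (RLoad 0 ka (IReg 4)))
  (Seq (Instr (RLoad 1 ka (IReg 5)))
  (If (BLeR (RReg 0) (RReg 1)) (Instr (IStore 1 (IReg 3) (IReg 4)))
                               (Instr (IStore 1 (IReg 3) (IReg 5))))))))).

Definition tree_leaves : program :=
  for_loop 2 (IReg 1) (Instr (IStore 1 (IAdd (IReg 1) (IReg 2)) (IReg 2))).

Definition tree_build_body (ka : nat) : program :=
  Seq (Instr (ISet 3 (ISub (ISub (IReg 1) (IConst 1)) (IReg 2))))
  (Seq (Instr (IStore 2 (IMul (IConst 2) (IReg 3)) (IReg 3)))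
  (Seq (Instr (IStore 2 (IAdd (IMul (IConst 2) (IReg 3)) (IConst 1)) (IReg 3)))
       (tree_node ka))).

Definition tree_build (ka : nat) : program := for_loop 2 (IReg 1) (tree_build_body ka).

Definition climb_body (ka : nat) : program :=
  Seq (Instr (ILoad 3 2 (IReg 3))) (tree_node ka).

Definition tree_climb (ka : nat) : program :=
  While (BLeI (IConst 2) (IReg 3)) (climb_body ka).

(* Output arrays are numbered from 3: arrays 1 and 2 hold the tree. *)
Definition cluster_step (ka ca : nat) (tau : int) : program :=
  Seq (Instr (ILoad 4 1 (IConst 1)))
  (Seq (Instr (RLoad 0 ka (IReg 4)))
  (Seq (If (BAnd (BLeI (IConst 1) (IReg 6))
                 (BLeR (RSub (RReg 0) (RReg 2)) (ROfInt (IConst tau))))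
           Skip
           (Seq (Instr (ISet 6 (IAdd (IReg 6) (IConst 1)))) (Instr (RSet 2 (RReg 0)))))
  (Seq (Instr (IStore ca.+3 (IReg 4) (ISub (IReg 6) (IConst 1))))
  (Seq (Instr (IStore 1 (IAdd (IReg 1) (IReg 4)) (IConst (-1))))
       (Instr (ISet 3 (IAdd (IReg 1) (IReg 4)))))))).

Definition cluster (ka ca : nat) (tau : int) : program :=
  Seq (Instr (IStore 1 (IConst 0) (IConst (-1))))
  (Seq tree_leaves
  (Seq (tree_build ka)
  (Seq (Instr (ISet 6 (IConst 0)))
       (for_loop 2 (IReg 1) (Seq (cluster_step ka ca tau) (tree_climb ka)))))).

Section Tournament.
Variables (R : realType) (m : nat) (K : nat -> R).
Implicit Types (A : pred nat) (a b z : int) (t : nat -> int).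

Definition best a b : int :=
  if a <= -1 then b else if b <= -1 then a else
  if K `|a|%N <= K `|b|%N then a else b.

Definition entry A z : Prop := z = -1 \/ exists2 i, z = i%:Z & A i.

Definition beats z i : Prop := exists2 j, z = j%:Z & K j <= K i.

Lemma best_entry A a b : entry A a -> entry A b -> entry A (best a b).
Proof. by rewrite /best => ha hb; case: ifP => // _; case: ifP => // _; case: ifP. Qed.

Lemma best_beats_l A a b i : entry A b -> beats a i -> beats (best a b) i.
Proof.
rewrite /best => hb [j -> le_j]; rewrite (_ : (j%:Z <= -1) = false) /=; last by lia.
case: hb => [->|[j' -> _]]; first by exists j.
rewrite (_ : (j'%:Z <= -1) = false) /= ?absz_nat; last by lia.
case: (leP (K j)) => lt; first by exists j.
by exists j' => //; apply: le_trans le_j; apply: ltW.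
Qed.

Lemma best_beats_r A a b i : entry A a -> beats b i -> beats (best a b) i.
Proof.
rewrite /best => ha [j -> le_j].
case: ha => [->|[j' -> _]]; first by exists j.
rewrite (_ : (j'%:Z <= -1) = false) /= ?absz_nat; last by lia.
case: (leP (K j')) => lt; last by exists j.
by exists j' => //; apply: le_trans le_j.
Qed.

Record tree_ok A t : Prop := TreeOk {
  tree_node_ok u : (0 < u < m)%N -> t u = best (t u.*2) (t u.*2.+1);
  tree_leaf_ok i : (i < m)%N -> t (m + i)%N = if A i then i%:Z else -1 }.

(** Children have larger numbers than their parent, hence an induction from the last leaf
    downwards. *)
Lemma tree_entry A t u : tree_ok A t -> (0 < u < m.*2)%N -> entry A (t u).
Proof.
move=> [hn hl]; have [d] := ubnP (m.*2 - u)%N; elim: d u => // d IH u lt_d /andP[u0 um].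
have [u_m|m_u] := ltnP u m.
  by rewrite hn ?u0 //; apply: best_entry; apply: IH; lia.
rewrite -(subnKC m_u) hl; last by lia.
by case: ifP => Ai; [right; exists (u - m)%N | left].
Qed.

(** Repeated halving leads from any leaf to node 1, for every [m] and not only for powers of two,
    and each step up preserves [beats]. For [m = 1] the leaf is itself the root. *)
Lemma tree_min A t i : tree_ok A t -> (i < m)%N -> A i -> beats (t 1%N) i.
Proof.
move=> ok im Ai.
have: beats (t (m + i)%N) i by rewrite (tree_leaf_ok ok) // Ai; exists i.
have: (0 < m + i < m.*2)%N by lia.
elim/ltn_ind: (m + i)%N => u IH /andP[u0 um] bu.
have [u1|u1] := leqP u 1; first by rewrite (_ : 1%N = u) //; lia.
have lt : (u./2 < u)%N by lia.
apply: (IH _ lt); first by lia.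
rewrite (tree_node_ok ok); last by lia.
have := odd_double_half u; case: (odd u) => /= E.
  apply: best_beats_r; last by rewrite -add1n E.
  by apply: (tree_entry ok); lia.
apply: best_beats_l; last by rewrite -[_./2.*2]add0n E.
by apply: (tree_entry ok); lia.
Qed.

Definition proper_ancestor u v : Prop := exists j, u = iter j.+1 half v.

(** A tree under repair: [v] is the last node brought up to date, and only its proper ancestors may
    still be stale. *)
Record tree_but A t v : Prop := TreeBut {
  but_node u : (0 < u < m)%N -> ~ proper_ancestor u v -> t u = best (t u.*2) (t u.*2.+1);
  but_leaf i : (i < m)%N -> t (m + i)%N = if A i then i%:Z else -1 }.

Lemma tree_but_leaf A t p : tree_ok A t -> (p < m)%N ->
  tree_but (fun i => A i && (i != p))
           (fun u => if u == (m + p)%N then -1 else t u) (m + p).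
Proof.
move=> [hn hl] pm; split=> [u um nanc|i im]; last first.
  rewrite eqn_add2l hl //; case: (i == p) => /=; first by rewrite andbF.
  by rewrite andbT.
have nh : (m + p)./2 <> u by move=> E; apply: nanc; exists 0%N.
have skip x : x <> (m + p)%N -> (if x == (m + p)%N then -1 else t x) = t x.
  by move/eqP/negbTE=> ->.
by rewrite !skip; [exact: hn| lia..].
Qed.

(** Recomputing [v./2] can disturb only the node that reads it, namely its parent, which is again a
    proper ancestor. *)
Lemma tree_but_up A t t' v : (1 < v < m.*2)%N -> tree_but A t v ->
  t' v./2 = best (t v./2.*2) (t v./2.*2.+1) ->
  (forall u, u != v./2 -> t' u = t u) -> tree_but A t' v./2.
Proof.
move=> v1 [hn hl] E1 E2; split=> [u um nanc|i im]; last by rewrite E2 ?hl //; lia.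
have [->|ne] := eqVneq u v./2; first by rewrite E1 !E2 //; lia.
have ne2 : u <> v./2./2 by move=> E; apply: nanc; exists 0%N.
rewrite !E2; [apply: hn => // | lia..].
by case=> -[|j] /= E; [rewrite E eqxx in ne | apply: nanc; exists j; rewrite E -iterSr].
Qed.

Lemma tree_but_root A t v : (v <= 1)%N -> tree_but A t v -> tree_ok A t.
Proof.
move=> v1 [hn hl]; split=> // u um; apply: hn => // -[j E].
have h0 k : iter k half 0%N = 0%N by elim: k => //= k ->.
move: um; rewrite E iterSr (_ : v./2 = 0%N) ?h0 //.
by case: v v1 {E} => [|[]].
Qed.

End Tournament.

(** * Greedy clustering of keys met in increasing order *)

Section Clustering.
Variables (R : realType) (K : nat -> R) (tau : R).
Hypothesis tau_ge0 : 0 <= tau.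

(* [D] lists the clustered indices, [c] is the number of clusters opened so far, and
   [l] is the least key of the last one. *)
Record clustering (D : seq nat) (C : nat -> nat) (c : nat) (l : R) : Prop := Clustering {
  cl_lt i : i \in D -> (C i < c)%N;
  cl_last i : i \in D -> (C i).+1 = c -> l <= K i <= l + tau;
  cl_same i j : i \in D -> j \in D -> C i = C j -> K i <= K j + tau;
  cl_gap i j d : i \in D -> j \in D -> (C i + d < C j)%N -> K i + tau *+ d < K j;
  cl_front i d : i \in D -> ((C i + d).+1 < c)%N -> K i + tau *+ d < l }.

Lemma clustering_same D C C' c l p : clustering D C c.+1 l -> p \notin D ->
  {in D, C' =1 C} -> C' p = c -> l <= K p -> K p <= l + tau ->
  clustering (p :: D) C' c.+1 l.
Proof.
move=> [h1 h2 h3 h4 h5] pD E Ep lp pl; split.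
- by move=> i; rewrite inE => /predU1P[->|iD]; [rewrite Ep | rewrite E ?h1].
- by move=> i; rewrite inE => /predU1P[->|iD]; [rewrite lp pl | rewrite E //; apply: h2].
- move=> i j; rewrite !inE => /predU1P[->|iD] /predU1P[->|jD].
  + by rewrite lerDl.
  + by rewrite Ep E // => Ec; have /andP[] := h2 j jD (congr1 S (esym Ec)); lra.
  + by rewrite Ep E // => Ec; have /andP[] := h2 i iD (congr1 S Ec); lra.
  + by rewrite !E //; apply: h3.
- move=> i j d; rewrite !inE => /predU1P[->|iD] /predU1P[->|jD].
  + by lia.
  + by rewrite Ep E // => lt; have := h1 j jD; lia.
  + by rewrite Ep E // => lt; apply: lt_le_trans lp; apply: h5; lia.
  + by rewrite !E //; apply: h4.
- move=> i d; rewrite inE => /predU1P[->|iD]; first by rewrite Ep; lia.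
  by rewrite E //; apply: h5.
Qed.

(** The least keys of successive clusters are more than [tau] apart, so these gaps add up: a
    difference of more than [d] in cluster numbers forces a difference of more than [d] times [tau]
    in keys. *)
Lemma clustering_new D C C' c l p : clustering D C c l -> p \notin D ->
  {in D, C' =1 C} -> C' p = c -> ((0 < c)%N -> l + tau < K p) ->
  clustering (p :: D) C' c.+1 (K p).
Proof.
move=> [h1 h2 h3 h4 h5] pD E Ep lp.
(* For positive [d] the last gap, from [l] to [K p], is added to [cl_front]; for [d = 0] the key
   lies in the last cluster or before it, thus at most at [l + tau]. *)
have front i d : i \in D -> (C i + d < c)%N -> K i + tau *+ d < K p.
  move=> iD lt; have {}lp := lp (leq_ltn_trans (leq0n _) lt).
  case: d lt => [|d] lt.
    rewrite mulr0n addr0; apply: le_lt_trans lp.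
    have [lt2|ge] := ltnP (C i + 0).+1 c.
      by have := h5 i 0%N iD lt2; rewrite mulr0n addr0; move: tau_ge0; lra.
    have Ec : (C i).+1 = c by lia.
    by have /andP[_] := h2 i iD Ec; lra.
  by move: tau_ge0; rewrite mulrSr; have := h5 i d iD; rewrite -addnS => /(_ lt); lra.
split.
- by move=> i; rewrite inE => /predU1P[->|iD]; [rewrite Ep | rewrite E // leqW ?h1].
- move=> i; rewrite inE => /predU1P[->|iD]; first by rewrite lexx lerDl tau_ge0.
  by rewrite E // => -[Ec]; have := h1 i iD; lia.
- move=> i j; rewrite !inE => /predU1P[->|iD] /predU1P[->|jD].
  + by rewrite lerDl.
  + by rewrite Ep E // => Ec; have := h1 j jD; lia.
  + by rewrite Ep E // => Ec; have := h1 i iD; lia.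
  + by rewrite !E //; apply: h3.
- move=> i j d; rewrite !inE => /predU1P[->|iD] /predU1P[->|jD].
  + by lia.
  + by rewrite Ep E // => lt; have := h1 j jD; lia.
  + by rewrite Ep E //; apply: front.
  + by rewrite !E //; apply: h4.
- move=> i d; rewrite inE => /predU1P[->|iD]; first by rewrite Ep; lia.
  by rewrite E // => lt; apply: front.
Qed.

End Clustering.

(** * Correctness and cost of the clustering program *)

Section ClusterProgram.
Variables (R : realType) (N m ka : nat) (K : nat -> R).
Hypothesis m_N : (m.*2.+2 <= N)%N.
Implicit Types (st : state R).

Definition cluster_input st : Prop :=
  ireg st 1 = m%:Z /\ forall i, (i < m)%N -> rarr st (ka, i) = K i.

Definition tree st (u : nat) : int := iarr st (1%N, u).

Lemma wp_tree_node st v : cluster_input st -> ireg st 3 = v%:Z -> (v < m)%N ->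
  entry (gtn m) (tree st v.*2) -> entry (gtn m) (tree st v.*2.+1) ->
  wp N (tree_node ka) (ticks (tree_node ka)) (fun st' =>
    tree st' v = best K (tree st v.*2) (tree st v.*2.+1) /\
    forall u, u != v -> tree st' u = tree st u) st.
Proof.
move=> [_ HK] r3 vm; rewrite /tree => e1 e2; apply: wp_ticks => //.
apply: wp_seq; apply: (@wp_iload _ _ v.*2); rewrite /= ?r3; [lia|lia|].
apply: wp_seq; apply: (@wp_iload _ _ v.*2.+1); rewrite /= ?r3; [lia|lia|].
set a := iarr st _ in e1 *; set b := iarr st _ in e2 *; clearbody a b.
have upd c : (if (1%N, v) == (1%N, v) then c else iarr st (1%N, v)) = c by rewrite eqxx.
have other c u : u != v ->
    (if (1%N, u) == (1%N, v) then c else iarr st (1%N, u)) = iarr st (1%N, u).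
  by move=> /negbTE uv; rewrite xpair_eqE /= uv.
apply: wp_if => /= a0.
  apply: (@wp_istore _ _ v) => /=; [done|lia|split].
    by rewrite upd /best a0.
  exact: other.
apply: wp_if => /= b0.
  apply: (@wp_istore _ _ v) => /=; [done|lia|split].
    by rewrite upd /best (negbTE a0) b0.
  exact: other.
case: e1 => [ea|[i Ei im]]; first by rewrite ea in a0.
case: e2 => [eb|[j Ej jm]]; first by rewrite eb in b0.
rewrite /= in im jm; subst a b.
apply: wp_seq; apply: (@wp_rload _ _ i) => /=; [done|lia|].
apply: wp_seq; apply: (@wp_rload _ _ j) => /=; [done|lia|].
rewrite /best (negbTE a0) (negbTE b0) !absz_nat.
apply: wp_if => /=; rewrite !HK // => le.
  apply: (@wp_istore _ _ v) => /=; [done|lia|split].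
    by rewrite upd le.
  exact: other.
apply: (@wp_istore _ _ v) => /=; [done|lia|split].
  by rewrite upd (negbTE le).
exact: other.
Qed.

Lemma frame_cluster_input c st st' : frame c st st' -> ~~ writes_ireg c 1 ->
  ~~ writes_rarr c ka -> cluster_input st -> cluster_input st'.
Proof.
move=> [fi _ _ fr] w1 w2 [E1 E2]; split=> [|i im]; first by rewrite fi.
by rewrite fr // E2.
Qed.

Lemma wp_tree_leaves st : cluster_input st -> tree st 0 = -1 ->
  wp N tree_leaves (3 * m.+1) (fun st' =>
    [/\ cluster_input st', tree st' 0 = -1 &
        forall i, (i < m)%N -> tree st' (m + i) = i%:Z]) st.
Proof.
move=> hin h0.
apply: wp_weaken (wp_for (I := fun i st' => [/\ cluster_input st', tree st' 0 = -1 &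
        forall u, (u < i)%N -> tree st' (m + u) = u%:Z]) (n := m) (T := 1) _ _ _ _) _ _;
  last by move=> st'; apply.
- by move=> i st1 [[r1 _] _ _] _ _ /=; rewrite r1; lia.
- by split.
- move=> i st1 [[r1 HK] t0 ht] im r2.
  apply: (@wp_istore _ _ (m + i)) => /=; [by rewrite r1 r2 | lia|].
  split=> //; split=> // [|u ui].
    rewrite /tree /= xpair_eqE /= ifN ?[iarr _ _]t0 //; lia.
  rewrite /tree /= xpair_eqE /= eqn_add2l; case: eqP => [->//|ne].
  by apply: ht; lia.
- by [].
- by [].
Qed.

Definition half_table st : Prop :=
  forall v, (v < m.*2)%N -> iarr st (2%N, v) = v./2%:Z.

(** Nodes are treated from [m - 1] downwards, so that children are ready. The last round, for node
    0, also writes the entries 0 and 1 of the table of halves; it reads the nodes 0 and 1 as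
    children, so node 0 must hold a valid entry beforehand. *)
Lemma wp_tree_build st : cluster_input st -> tree st 0 = -1 ->
  (forall i, (i < m)%N -> tree st (m + i) = i%:Z) ->
  wp N (tree_build ka) ((ticks (tree_build_body ka)).+2 * m.+1) (fun st' =>
    [/\ cluster_input st', half_table st', entry (gtn m) (tree st' 0) &
        tree_ok m K (gtn m) (tree st')]) st.
Proof.
move=> hin h0 hl.
pose I i st' := [/\ cluster_input st', forall v, (m.*2 <= v + i.*2)%N -> (v < m.*2)%N ->
   iarr st' (2%N, v) = v./2%:Z, entry (gtn m) (tree st' 0),
   forall j, (j < m)%N -> tree st' (m + j) = j%:Z &
   forall u, (m <= u + i)%N -> (0 < u < m)%N ->
     tree st' u = best K (tree st' u.*2) (tree st' u.*2.+1)].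
apply: wp_weaken (wp_for (I := I) (n := m) (T := ticks (tree_build_body ka)) _ _ _ _) _ _; last by move=> st'; apply.
- by move=> i st1 [[r1 _]] _ _ _ _ _ _ /=; rewrite r1; lia.
- split=> //; [|by left|]; lia.
- move=> i st1 [[r1 HK] hh e0 ht hn] im r2.
  have v_lt : (m - 1 - i < m)%N by lia.
  set v := (m - 1 - i)%N in v_lt.
  have Ev : (v + i + 1)%N = m by rewrite /v; lia.
  clearbody v; apply: wp_ticks => //.
  apply: wp_seq; apply: wp_iset => /=; rewrite r1 r2.
  rewrite (_ : (m%:Z - 1 - i%:Z)%R = v%:Z); last by lia.
  apply: wp_seq; apply: (@wp_istore _ _ v.*2) => /=; [lia|lia|].
  apply: wp_seq; apply: (@wp_istore _ _ v.*2.+1) => /=; [lia|lia|].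
  have low u : (m <= u + i)%N -> (u < m.*2)%N -> entry (gtn m) (tree st1 u).
    move=> ui um.
    have [d] := ubnP (m.*2 - u)%N; elim: d u ui um => // d IH u ui um lt_d.
    have [u_m|m_u] := ltnP u m; last first.
      by right; exists (u - m)%N; rewrite /= -?ht ?subnKC //; lia.
    case: (posnP u) => [->//|u0].
    by rewrite hn //; [apply: best_entry; apply: IH; lia | lia].
  have ch u : (u == v.*2) || (u == v.*2.+1) -> entry (gtn m) (tree st1 u).
    move=> hu; case: (posnP u) => [->//|u0].
    by apply: low; lia.
  set st2 := set_iarr _ _ _.
  have w := @wp_tree_node st2 v (conj r1 HK) erefl v_lt
    (ch _ (introT orP (or_introl (eqxx _)))) (ch _ (introT orP (or_intror (eqxx _)))).
  apply: wp_weaken (wp_frame (wp_weaken w (leqnn _) _)) (leqnn _) (fun _ => id).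
  move=> st3 [hv hu] F.
  have Ft u : tree st2 u = tree st1 u by [].
  split; first by rewrite (frame_ireg F).
  split.
  + by case: (frame_cluster_input F isT isT (conj r1 HK : cluster_input st2)).
  + move=> u mu um; rewrite /= (frame_iarr F) // /st2 /= !xpair_eqE /=.
    case: eqP => [->|ne1]; first by congr Posz; lia.
    case: eqP => [->|ne2]; first by congr Posz; lia.
    by apply: hh => //; lia.
  + have [v0|nv] := eqVneq 0%N v; last by rewrite /tree /= -/(tree _ _) hu // Ft.
    rewrite /tree /= -/(tree _ _) {1}v0 hv; apply: best_entry; apply: ch.
      by rewrite eqxx.
    by rewrite eqxx orbT.
  + by move=> j jm; rewrite /tree /= -/(tree _ _) hu ?Ft ?ht //; lia.
  + move=> u mu um; rewrite /tree /= -!/(tree _ _).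
    have [u_v|ne] := eqVneq u v.
      by subst u; rewrite hv !hu //; lia.
    rewrite !hu ?Ft //; try lia.
    by apply: hn => //; lia.
- move=> st1 [hin1 hh e0 ht hn] r2; split=> //.
    by move=> v vm; apply: hh => //; lia.
  split=> [u um|i im]; first by apply: hn => //; lia.
  by rewrite ht //= im.
- by [].
Qed.

(** Halving [v] lowers its logarithm by one, and each round moves the stale region of [tree_but] one
    level up. *)
Lemma wp_tree_climb A st v : cluster_input st -> half_table st ->
  (forall u, (u < m.*2)%N -> entry (gtn m) (tree st u)) ->
  tree_but m K A (tree st) v -> ireg st 3 = v%:Z -> (v < m.*2)%N ->
  wp N (tree_climb ka) ((ticks (climb_body ka)).+1 * trunc_log 2 v + 1) (fun st' =>
    [/\ cluster_input st', half_table st', entry (gtn m) (tree st' 0) &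
        tree_ok m K A (tree st')]) st.
Proof.
elim/ltn_ind: v st => v IH st hin hh he hb r3 vm.
have [v1|v1] := leqP v 1.
  set Q := (fun st' => _); suff w : wp N (tree_climb ka) 1 Q st.
    by apply: wp_weaken w _ (fun _ => id); rewrite addn1.
  apply: wp_while_stop; first by rewrite /= r3; lia.
  by split=> //; [apply: he; lia | apply: tree_but_root hb].
rewrite trunc_log2S // mulnS -addnA addSn.
have h_lt : (v./2 < v)%N by lia.
have hm : (v./2 < m)%N by lia.
apply: (wp_while_loop (c := climb_body ka)); first by rewrite /= r3.
apply: wp_ticks => //; apply: wp_seq; apply: (@wp_iload _ _ v); [by rewrite /= r3|lia|].
rewrite hh //; set st2 := set_ireg _ _ _.
have e1 : entry (gtn m) (tree st2 v./2.*2) by apply: he; lia.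
have e2 : entry (gtn m) (tree st2 v./2.*2.+1) by apply: he; lia.
have hin2 : cluster_input st2 by [].
apply: wp_weaken (wp_frame (wp_weaken (wp_tree_node hin2 erefl hm e1 e2) (leqnn _) _))
  (leqnn _) (fun _ => id).
move=> st3 [hv hu] F; apply: (IH _ h_lt).
- exact: frame_cluster_input F isT isT hin2.
- by move=> u um; rewrite (frame_iarr F) // hh.
- move=> u um; have [->|ne] := eqVneq u v./2; first by rewrite hv; apply: best_entry.
  by rewrite hu //; apply: he.
- by apply: tree_but_up hb _ _ => //; lia.
- by rewrite (frame_ireg F).
- by lia.
Qed.

(** [D] lists the indices extracted so far, and the tree holds the others. That the scan is sorted
    enters only through the last clause: the remaining keys are at least [l]. *)
Record cluster_inv (ca : nat) (tau : int) (j : nat) st : Prop := ClusterInv {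
  ci_input : cluster_input st;
  ci_half : half_table st;
  ci_root : entry (gtn m) (tree st 0);
  ci_state : exists D C c l,
    [/\ [/\ uniq D, size D = j & all (gtn m) D],
        tree_ok m K (fun i => (i < m)%N && (i \notin D)) (tree st),
        [/\ clustering K tau%:~R D C c l, ireg st 6 = c%:Z, rreg st 2 = l & (c <= j)%N],
        (forall i, i \in D -> iarr st (ca.+3, i) = (C i)%:Z) &
        (0 < c)%N -> forall i, (i < m)%N -> i \notin D -> l <= K i] }.

Lemma wp_cluster_loop_body ca tau j st : 0 <= tau -> (j < m)%N ->
  cluster_inv ca tau j st ->
  wp N (Seq (cluster_step ka ca tau) (tree_climb ka))
     (ticks (cluster_step ka ca tau) + ((ticks (climb_body ka)).+1 * trunc_log 2 m.*2 + 1))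
     (cluster_inv ca tau j.+1) st.
Proof.
move=> tau0 jm [[r1 HK] hh e0 [D [C [c [l [[uD sD aD] htree [hcl r6 rr2 cj] hC hl]]]]]].
have D_m i : i \in D -> (i < m)%N by move=> iD; apply: (allP aD).
(* Fewer than [m] indices have been extracted, so one is left and the root is not empty. *)
have [i0 i0m i0D] : exists2 i, (i < m)%N & i \notin D.
  have [/hasP[i]|/hasPn H] := boolP (has (fun i => i \notin D) (iota 0 m)).
    by rewrite mem_iota add0n => /= im iD; exists i.
  have: (size (iota 0 m) <= size D)%N.
    by apply: uniq_leq_size (iota_uniq _ _) _ => i /H; rewrite negbK.
  by rewrite size_iota sD leqNgt jm.
have: entry (fun i => (i < m)%N && (i \notin D)) (tree st 1).
  by apply: (tree_entry htree); lia.
case=> [E|[p Ep /andP[pm pD]]].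
  by have [q] := tree_min htree i0m (introT andP (conj i0m i0D)); rewrite E.
have pmin i : (i < m)%N -> i \notin D -> K p <= K i.
  move=> im iD; have [q] := tree_min htree im (introT andP (conj im iD)).
  by rewrite Ep => -[->].
(* Before the first extraction register 2 holds no least key; the conjunct [0 < c] then forces a
   cluster to be opened. *)
pose same := (0 < c)%N && (K p - l <= tau%:~R).
pose c' := if same then c else c.+1.
pose l' := if same then l else K p.
pose C' i := if i == p then c'.-1 else C i.
have cl' : clustering K tau%:~R (p :: D) C' c' l'.
  have EC : {in D, C' =1 C}.
    by move=> i iD; rewrite /C' ifN //; apply: contraNneq pD => <-.
  have EC' : C' p = c'.-1 by rewrite /C' eqxx.
  rewrite /c' /l' in EC' *; case: ifP EC' => [/andP[c0 le] EC'|/negbT ns EC'].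
    case: (c) c0 hcl hl EC' le => // c1 c0 hcl hl EC' le.
    by apply: (clustering_same _ hcl) => //; [rewrite ler0z | exact: hl | move: le; lra].
  apply: (clustering_new _ hcl) => //; first by rewrite ler0z.
  by move=> c0; move: ns; rewrite /same c0 /= -ltNge; lra.
have c'1 : (c' = c'.-1.+1)%N.
  by rewrite /c'; case: ifP => // /andP[c0 _]; rewrite prednK.
have c'Z : c'%:Z - 1 = c'.-1%:Z by rewrite {1}c'1 -addn1 PoszD addrK.
pose mid st1 := [/\ cluster_input st1, ireg st1 3 = (m + p)%:Z,
   ireg st1 6 = c'%:Z /\ rreg st1 2 = l',
   (forall u, iarr st1 (1%N, u) = if u == (m + p)%N then -1 else iarr st (1%N, u)) &
   (forall i, iarr st1 (2%N, i) = iarr st (2%N, i)) /\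
   forall i, iarr st1 (ca.+3, i) = if i == p then c'.-1%:Z else iarr st (ca.+3, i)].
apply: (@wp_seq _ _ _ _ _ _ _ _).
have step : wp N (cluster_step ka ca tau) (ticks (cluster_step ka ca tau)) mid st.
  apply: wp_ticks => //.
  apply: wp_seq; apply: (@wp_iload _ _ 1%N) => //; first by lia.
  rewrite -/(tree st 1) Ep.
  apply: wp_seq; apply: (@wp_rload _ _ p) => //=; first by lia.
  rewrite HK //.
  pose st3 := set_ireg (set_rreg (set_ireg st 4 p%:Z) 0 (K p)) 6 c'%:Z.
  apply: wp_seq.
  apply: (@wp_weaken _ _ _ _ _ (fun st4 => [/\ ireg st4 6 = c'%:Z, rreg st4 2 = l',
     ireg st4 4 = p%:Z, ireg st4 1 = m%:Z &
     (forall i, (i < m)%N -> rarr st4 (ka, i) = K i) /\ iarr st4 = iarr st])).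
  - apply: wp_if => /=; rewrite r6 rr2.
      move=> hs; have {}hs : same by move: hs; rewrite /same.
      by apply: wp_skip; rewrite /c' /l' hs.
    move=> hs; have {}hs : same = false by apply: negbTE; move: hs; rewrite /same.
    apply: wp_seq; apply: wp_iset; apply: wp_rset => /=; rewrite r6 /c' /l' hs.
    by split=> //; lia.
  - by [].
  move=> st4 [s6 sr2 s4 s1 [sK sA]].
  apply: wp_seq; apply: (@wp_istore _ _ p); [by rewrite /= s4|lia|].
  apply: wp_seq; apply: (@wp_istore _ _ (m + p)%N); [by rewrite /= s4 s1|lia|].
  apply: wp_iset; split=> //=.
  - by rewrite s1 s4.
  - by move=> u; rewrite !xpair_eqE /= sA.
  - by split=> i; [rewrite sA | rewrite xpair_eqE eqxx /= sA s6 c'Z].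
apply: wp_weaken (wp_frame (wp_weaken step (leqnn _) _)) (leqnn _) (fun _ => id).
move=> st1 [hin1 s3 [s6 sr2] sT [sH sC]] _.
have eqt u : tree st1 u = if u == (m + p)%N then -1 else tree st u by exact: sT.
have but : tree_but m K (fun i => (i < m)%N && (i \notin p :: D)) (tree st1) (m + p).
  have [b1 b2] := tree_but_leaf htree pm; split=> [u um na|i im].
    by rewrite !eqt b1.
  by rewrite eqt b2 // inE negb_or andbA [in RHS]andbAC.
have ent u : (u < m.*2)%N -> entry (gtn m) (tree st1 u).
  move=> um; rewrite eqt; case: ifP => _; first by left.
  case: (posnP u) => [-> //|u0].
  have: entry (fun i => (i < m)%N && (i \notin D)) (tree st u).
    by apply: (tree_entry htree); lia.
  case=> [->|[i -> /andP[im _]]]; first by left.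
  by right; exists i.
have hh1 : half_table st1 by move=> v vm; rewrite sH hh.
have climb := wp_tree_climb hin1 hh1 ent but s3.
apply: wp_weaken (wp_frame (wp_weaken (climb _) (leqnn _) _)) _ (fun _ => id); first by lia.
  move=> st2 [hin2 hh2 e2 ok2] F; split=> //.
  exists (p :: D), C', c', l'; split=> //.
  - by split=> //=; rewrite ?pD ?uD ?sD ?pm.
  - split=> //; rewrite ?(frame_ireg F) ?(frame_rreg F) //.
    by rewrite /c'; case: ifP => // _; apply: leqW.
  - move=> i; rewrite inE (frame_iarr F) // sC /C'.
    by case: eqP => // _ /=; apply: hC.
  - rewrite /c' /l'; case: ifP => _ => [c0|_] i im; rewrite inE negb_or => /andP[_ iD].
      exact: hl.
    exact: pmin.
by rewrite leq_add2r leq_mul2l /= leq_trunc_log //; lia.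
Qed.

Definition cluster_cost (ca : nat) (tau : int) : nat :=
  (ticks (tree_build_body ka) + ticks (cluster_step ka ca tau) + ticks (climb_body ka) + 20)%N.

Lemma wp_cluster ca tau st : 0 <= tau -> cluster_input st ->
  wp N (cluster ka ca tau) (cluster_cost ca tau * (m.+1 * (trunc_log 2 m.*2).+1))
    (fun st' => exists C : nat -> nat,
      [/\ forall i, (i < m)%N -> iarr st' (ca.+3, i) = (C i)%:Z,
          forall i, (i < m)%N -> (C i < m)%N,
          forall i j, (i < m)%N -> (j < m)%N -> C i = C j -> K i <= K j + tau%:~R &
          forall i j d, (i < m)%N -> (j < m)%N -> (C i + d < C j)%N ->
            K i + tau%:~R *+ d < K j]) st.
Proof.
move=> tau0 hin.
set T := (_ * _)%N; set Q := (fun st' => _).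
set g := trunc_log 2 m.*2 in T *.
set a := ticks (tree_build_body ka); set b := ticks (cluster_step ka ca tau).
set d := ticks (climb_body ka).
apply: (@wp_weaken _ _ _ (1 + (3 * m.+1 + (a.+2 * m.+1 + (1 + (b + (d.+1 * g + 1)).+2 * m.+1)))) _ Q);
  [|by rewrite /T /cluster_cost -/a -/b -/d; nia|by []].
apply: wp_seq; apply: (@wp_istore _ _ 0%N) => //; first by lia.
set st1 := set_iarr _ _ _.
have hin1 : cluster_input st1 by [].
apply: wp_seq; apply: wp_weaken (wp_tree_leaves hin1 erefl) (leqnn _) _.
move=> st2 [hin2 t2 l2].
apply: wp_seq; apply: wp_weaken (wp_tree_build hin2 t2 l2) (leqnn _) _.
move=> st3 [hin3 hh3 e3 ok3].
apply: wp_seq; apply: wp_iset.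
apply: (wp_for (I := cluster_inv ca tau) (n := m)).
- by move=> i s [[r1 _] _ _ _] _ _ /=; rewrite r1; lia.
- split=> //; exists [::], (fun=> 0%N), 0%N, (rreg st3 2); split=> //.
  case: ok3 => o1 o2; split=> // i im; rewrite -[LHS]/(tree st3 (m + i)) o2 //.
  by rewrite /= im.
- move=> i s hs im r2; have := wp_cluster_loop_body tau0 im hs.
  move=> /(wp_weaken (T' := (b + (d.+1 * g + 1))) (Q' := cluster_inv ca tau i.+1)).
  move=> /(_ (leqnn _) (fun _ => id)) w.
  apply: wp_weaken (wp_frame (wp_weaken w (leqnn _) _)) (leqnn _) (fun _ => id).
  move=> s' [h1 h2 h3 [D [C [c [l [k1 k2 [k3 k4 k5 k6] k7 k8]]]]]] F.
  split; first by rewrite (frame_ireg F).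
  by split=> //; exists D, C, c, l.
- move=> s [_ _ _ [D [C [c [l [[uD sD aD] _ [hcl _ _ cm] hC _]]]]]] _.
  have memD i : (i < m)%N -> i \in D.
    have sub : {subset D <= iota 0 m} by move=> x /(allP aD); rewrite mem_iota.
    have le : (size (iota 0 m) <= size D)%N by rewrite size_iota sD.
    by have [_ ->] := uniq_min_size uD sub le; rewrite mem_iota.
  exists C; split=> [i /memD/hC//|i /memD/(cl_lt hcl) lt|i j /memD iD /memD jD|i j k /memD iD /memD jD].
  - exact: leq_trans cm.
  - exact: (cl_same hcl).
  - exact: (cl_gap hcl).
Qed.

End ClusterProgram.

(** * Exact covers of small blocks and the cost of one shift *)

(* Sorted by size, so that the first mask passing a test is a smallest one. *)
Definition masks (m : nat) : seq (seq bool) :=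
  sort (fun a b => (count id a <= count id b)%N) (map val (enum {: m.-tuple bool})).

Lemma mem_masks m a : (a \in masks m) = (size a == m).
Proof.
rewrite mem_sort; apply/mapP/eqP => [[t _ ->]|E]; first exact: size_tuple.
by rewrite -E; exists (in_tuple a); rewrite ?mem_enum.
Qed.

Lemma find_masks_min m (P : pred (seq bool)) a : size a = m -> P a ->
  (count id (nth [::] (masks m) (find P (masks m))) <= count id a)%N.
Proof.
move=> sa Pa; have am : a \in masks m by rewrite mem_masks sa.
have lt : (index a (masks m) < size (masks m))%N by rewrite index_mem.
pose leT a b := (count id a <= count id b)%N.
have tr : transitive leT by move=> x y z; apply: leq_trans.
have so : sorted leT (masks m) by apply: sort_sorted => x y; apply: leq_total.
have lt2 : (find P (masks m) < size (masks m))%N by rewrite -has_find; apply/hasP; exists a.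
have le : (find P (masks m) <= index a (masks m))%N.
  by rewrite leqNgt; apply/negP => /(before_find [::]); rewrite nth_index // Pa.
have := sorted_leq_nth tr (fun x => leqnn _) [::] so _ _ lt2 lt le.
by rewrite nth_index.
Qed.

Lemma nth_mem_mask (T : eqType) (x0 : T) (m : seq bool) (s : seq T) a :
  size m = size s -> (a < size s)%N -> nth false m a -> nth x0 s a \in mask m s.
Proof.
elim: s m a => [|x s IH] [|b m] [|a] //= [E]; first by move=> _ ->; rewrite inE eqxx.
by move=> lt ma; case: b; rewrite ?inE IH ?orbT.
Qed.

(** A mask is a cover iff none of these pairs is an edge. The list depends only on [m] and the mask,
    so it can be expanded into a test of the program. *)
Definition unmarked_pairs (m : nat) (a : seq bool) : seq (nat * nat) :=
  [seq p <- [seq (x, y) | x <- iota 0 m, y <- iota 0 m] |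
     [&& (p.1 < p.2)%N, ~~ nth false a p.1 & ~~ nth false a p.2]].

Lemma mem_unmarked_pairs m a x y : ((x, y) \in unmarked_pairs m a) =
  [&& (x < y)%N, (y < m)%N, ~~ nth false a x & ~~ nth false a y].
Proof.
have -> : ((x, y) \in unmarked_pairs m a) = [&& (x < y)%N, ~~ nth false a x & ~~ nth false a y]
    && ((x < m)%N && (y < m)%N).
  rewrite mem_filter /=; congr andb; apply/allpairsP/andP => [[[u v] /= [um vm [-> ->]]]|[xm ym]].
    by move: um vm; rewrite !mem_iota.
  by exists (x, y); rewrite !mem_iota.
case: ltnP => //= xy; case: (ltnP y m) => ym; last by rewrite !andbF.
by rewrite (ltn_trans xy ym) /= andbT.
Qed.

Section LocalCover.
Variable edge : rel nat.
Hypothesis edge_sym : symmetric edge.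

(** The relation [close] used for [edge] below is reflexive, hence the condition [i != j]. *)
Definition covers (L : seq nat) (W : pred nat) : Prop :=
  forall i j, i \in L -> j \in L -> i != j -> edge i j -> W i \/ W j.

Definition mask_ok (L : seq nat) (a : seq bool) : bool :=
  all (fun p => ~~ edge (nth 0%N L p.1) (nth 0%N L p.2)) (unmarked_pairs (size L) a).

Definition local_mask (L : seq nat) : seq bool :=
  nth [::] (masks (size L)) (find (mask_ok L) (masks (size L))).

Definition local_cover (L : seq nat) : seq nat := mask (local_mask L) L.

Lemma has_mask_ok L : has (mask_ok L) (masks (size L)).
Proof.
apply/hasP; exists (nseq (size L) true); first by rewrite mem_masks size_nseq.
apply/allP => -[x y]; rewrite mem_unmarked_pairs => /and4P[xy yL].
by rewrite nth_nseq (ltn_trans xy yL).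
Qed.

Lemma size_local_mask L : size (local_mask L) = size L.
Proof.
by apply/eqP; rewrite -mem_masks mem_nth // -has_find has_mask_ok.
Qed.

Lemma local_cover_covers L : covers L (mem (local_cover L)).
Proof.
have ok : mask_ok L (local_mask L) by apply: nth_find; apply: has_mask_ok.
suff main x y : (x < y < size L)%N -> edge (nth 0%N L x) (nth 0%N L y) ->
    nth 0%N L x \in local_cover L \/ nth 0%N L y \in local_cover L.
  move=> i j iL jL ij e; rewrite -(nth_index 0%N iL) -(nth_index 0%N jL) in e *.
  have [lt|lt|E] := ltngtP (index i L) (index j L).
  - by apply: main; rewrite ?lt ?index_mem.
  - by apply/or_comm; apply: main; rewrite ?lt ?index_mem // edge_sym.
  - by move: ij; rewrite -(nth_index 0%N iL) E nth_index ?eqxx.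
move=> /andP[xy yL] e; have xL := ltn_trans xy yL.
have [mx|mx] := boolP (nth false (local_mask L) x).
  by left; apply: nth_mem_mask => //; apply: size_local_mask.
have [my|my] := boolP (nth false (local_mask L) y).
  by right; apply: nth_mem_mask => //; apply: size_local_mask.
have /= := allP ok (x, y); rewrite mem_unmarked_pairs xy yL mx my e.
by move=> /(_ isT).
Qed.

Lemma local_cover_min L W : covers L W -> uniq L -> (size (local_cover L) <= count W L)%N.
Proof.
move=> cW uL; rewrite size_mask ?size_local_mask //.
(* The restriction of [W] to [L], read as a mask, is one of the candidates searched. *)
have -> : count W L = count id (map W L) by rewrite count_map; apply: eq_count.
apply: find_masks_min; rewrite ?size_map //.
apply/allP => -[x y]; rewrite mem_unmarked_pairs => /and4P[xy yL].
have xL := ltn_trans xy yL; rewrite !(nth_map 0%N) // => Wx Wy; apply/negP => /= e.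
have := cW _ _ (mem_nth 0%N xL) (mem_nth 0%N yL) _ e.
by rewrite nth_uniq // ltn_eqF // => /(_ isT)[h|h]; rewrite h in Wx Wy.
Qed.

End LocalCover.

(** * Cover obtained from one shift, and its size *)

Section OneShift.
Variables (edge : rel nat) (n B K cells M : nat) (ids : nat -> seq nat).
Hypothesis edge_sym : symmetric edge.
Hypothesis ids_bound : forall i b, (i < n)%N -> b \in ids i -> (b < B)%N.

Definition block (b : nat) : seq nat := [seq i <- iota 0 n | b \in ids i].

Lemma mem_block b i : (i \in block b) = (i < n)%N && (b \in ids i).
Proof. by rewrite mem_filter mem_iota add0n andbC. Qed.

Lemma uniq_block b : uniq (block b).
Proof. by rewrite filter_uniq ?iota_uniq. Qed.

Hypothesis M_big : (K.+1 * cells <= M)%N.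

(** What is marked when point [i] is processed in block [b]. In a large block each point marks
    itself in its own turn; in a small one the whole local cover is marked again by every point, a
    repetition of constant work. *)
Definition marks (i b : nat) : seq nat :=
  if (M <= size (block b))%N then [:: i] else local_cover edge (block b).

Definition shift_cover : pred nat :=
  fun j => has (fun i => has (fun b => j \in marks i b) (ids i)) (iota 0 n).

Lemma shift_cover_covers :
  (forall i j, (i < n)%N -> (j < n)%N -> i != j -> edge i j ->
     exists2 b, b \in ids i & b \in ids j) ->
  covers edge (iota 0 n) shift_cover.
Proof.
move=> common i j; rewrite !mem_iota !add0n /= => i_n jn ij e.
have [b bi bj] := common i j i_n jn ij e.
have mark x y : (x < n)%N -> b \in ids x -> y \in marks x b -> shift_cover y.
  move=> xn bx yx; apply/hasP; exists x; first by rewrite mem_iota.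
  by apply/hasP; exists b.
have iL : i \in block b by rewrite mem_block i_n.
have jL : j \in block b by rewrite mem_block jn.
have [heavy|light] := boolP (M <= size (block b))%N.
  by left; apply: (mark i) => //; rewrite /marks heavy mem_seq1.
have [h|h] := local_cover_covers edge_sym iL jL ij e; [left|right];
  by apply: (mark i) => //; rewrite /marks (negbTE light).
Qed.

(** Each block is charged to the part of [W] in it; summed over the blocks, a point of [W] pays once
    for every distinct block it belongs to. Hence [undup], as several columns may name the same
    block. *)
Lemma shift_cover_size (W : pred nat) : covers edge (iota 0 n) W ->
  (forall b, (count (predC W) (block b) <= cells)%N) ->
  (K * count shift_cover (iota 0 n) <=
   K.+1 * \sum_(i < n) W i * size (undup (ids i)))%N.
Proof.
move=> cW few.
pose S b := if (M <= size (block b))%N then block b else local_cover edge (block b).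
(* Large block: at most [cells] of its points lie outside [W], so at least [K * cells] lie inside,
   and [K] times the outside is at most the inside. Small block: [W] restricted to it competes with
   the optimal local cover. *)
have S_size b : (K * size (S b) <= K.+1 * count W (block b))%N.
  rewrite /S; case: ifP => [heavy|_].
    have := count_predC W (block b); have := few b.
    by move: heavy M_big; nia.
  have : (size (local_cover edge (block b)) <= count W (block b))%N.
    apply: local_cover_min (uniq_block b) => i j.
    by rewrite !mem_block => /andP[i_n _] /andP[jn _]; apply: cW; rewrite mem_iota.
  by nia.
have cnt (P : pred nat) : count P (iota 0 n) = (\sum_(i < n) P i)%N.
  by rewrite -sum1_count -(big_mkord xpredT (fun i => nat_of_bool (P i))) /index_iota subn0 big_mkcond.
have V_S : (count shift_cover (iota 0 n) <= \sum_(b < B) size (S b))%N.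
  apply: (@leq_trans (\sum_(j < n) \sum_(b < B) (nat_of_ord j \in S b))%N).
    rewrite cnt; apply: leq_sum => j _; have [|//] := boolP (shift_cover j).
    case/hasP => i; rewrite mem_iota add0n /= => i_n /hasP[b bi jb].
    rewrite (bigD1 (Ordinal (ids_bound i_n bi))) //= (_ : (nat_of_ord j \in S b)) //.
    move: jb; rewrite /marks /S; case: ifP => // _; rewrite mem_seq1 => /eqP->.
    by rewrite mem_block i_n.
  rewrite exchange_big /=; apply: leq_sum => b _.
  rewrite -(cnt (mem (S b))) -size_filter; apply: uniq_leq_size.
    by rewrite filter_uniq ?iota_uniq.
  by move=> j; rewrite mem_filter => /andP[].
apply: (leq_trans (leq_mul (leqnn K) V_S)); rewrite big_distrr /=.
apply: (@leq_trans (\sum_(b < B) K.+1 * count W (block b))%N).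
  by apply: leq_sum => b _; apply: S_size.
rewrite -big_distrr leq_mul2l /=.
have cW2 b : count W (block b) = (\sum_(i < n) W i * (b \in ids (nat_of_ord i)))%N.
  rewrite count_filter cnt; apply: eq_bigr => i _ /=.
  by case: (W i); case: (b \in ids i).
rewrite (eq_bigr _ (fun b _ => cW2 (nat_of_ord b))) exchange_big /=.
apply: leq_sum => i _; rewrite -big_distrr leq_mul2l; apply/orP; right.
rewrite (_ : (\sum_(b < B) _)%N = count (mem (ids i)) (iota 0 B)); last first.
  by rewrite -sum1_count -(big_mkord xpredT (fun b => (b \in ids i) : nat)) /index_iota subn0 [RHS]big_mkcond.
rewrite -size_filter; apply: uniq_leq_size; first by rewrite filter_uniq ?iota_uniq.
by move=> b; rewrite mem_filter mem_undup => /andP[].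
Qed.

End OneShift.

(** * The program for all shifts *)

Definition ieq (e f : iexp) : bexp := BAnd (BLeI e f) (BLeI f e).

Definition ball (l : seq bexp) : bexp := foldr BAnd (BLeI (IConst 0) (IConst 0)) l.

Lemma beval_ieq (R : realType) (st : state R) e f :
  beval st (ieq e f) = (ieval st e == ieval st f).
Proof. by rewrite /= eq_le. Qed.

Lemma beval_ball (R : realType) (st : state R) l : beval st (ball l) = all (beval st) l.
Proof. by elim: l => //= b l ->. Qed.

Lemma loop_free_seqs l : loop_free (seqs l) = all loop_free l.
Proof. by elim: l => //= c l ->. Qed.

Lemma loop_free_unroll m f : (forall i, loop_free (f i)) -> loop_free (unroll m f).
Proof. by move=> h; rewrite loop_free_seqs all_map; apply/allP => i _; apply: h. Qed.

Lemma loop_free_chain (A : Type) b f (l : seq A) :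
  (forall a, loop_free (f a)) -> loop_free (chain b f l).
Proof. by move=> h; elim: l => //= a l ->; rewrite h. Qed.

Lemma writes_unrollF w m f x : (forall i, ~~ writes w (f i) x) -> ~~ writes w (unroll m f) x.
Proof. by move=> h; rewrite writes_unroll; apply/hasPn => i _; apply: h. Qed.

Lemma writes_chainF w A b f (l : seq A) x :
  (forall a, ~~ writes w (f a) x) -> ~~ writes w (chain b f l) x.
Proof. by move=> h; elim: l => //= a l IH; rewrite negb_or h. Qed.

Lemma mem_mask_iota (m : seq bool) (L : seq nat) j : size m = size L ->
  (j \in mask m L) = has (fun a => nth false m a && (nth 0%N L a == j)) (iota 0 (size L)).
Proof.
elim: L m => [|x L IH] [|b m] //= [E].
rewrite -[1%N]addn0 iotaDl has_map -(eq_has (a1 := fun a => nth false m a && (nth 0%N L a == j))) //.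
by rewrite -IH //; case: b; rewrite //= inE eq_sym.
Qed.

Lemma address_inj M b b' s s' : (s < M)%N -> (s' < M)%N ->
  (b * M + s == b' * M + s')%N = (b == b') && (s == s').
Proof.
move=> sM s'M; apply/eqP/andP => [E|[/eqP-> /eqP->//]].
have M0 : (0 < M)%N by lia.
have Eb : b = b'.
  by have := congr1 (divn^~ M) E; rewrite !divnMDl // !divn_small // !addn0.
by subst b'; split=> //; apply/eqP; lia.
Qed.

Definition fill (a q : nat) (v : int) : program :=
  for_loop 2 (IMul (IReg 0) (IConst q%:Z)) (Instr (IStore a (IReg 2) (IConst v))).

(* Column [w] of point [i] is stored at [i q + w] in array 5.  The points of block [b] are
   counted in array 7 and the first [M] of them listed from address [b M] of array 8.
   Array 9 receives the cover of the current shift, register 9 the size of the best cover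
   so far.  A point is skipped when it has already been put into the same block. *)
Definition insert_step (M q s c : nat) : program :=
  Seq (Instr (ILoad (20 + c) 5 (IAdd (IMul (IReg 2) (IConst q%:Z)) (IConst (s * 4 + c)%:Z))))
  (If (ball [seq BNot (ieq (IReg (20 + c)) (IReg (20 + c'))) | c' <- iota 0 c])
    (Seq (Instr (ILoad 10 7 (IReg (20 + c))))
    (Seq (If (BLeI (IAdd (IReg 10) (IConst 1)) (IConst M%:Z))
             (Instr (IStore 8 (IAdd (IMul (IReg (20 + c)) (IConst M%:Z)) (IReg 10)) (IReg 2)))
             Skip)
         (Instr (IStore 7 (IReg (20 + c)) (IAdd (IReg 10) (IConst 1))))))
    Skip).

Definition insert_loop (M q s : nat) : program :=
  for_loop 2 (IReg 0) (unroll 4 (insert_step M q s)).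

(** A block solved by search has fewer than [M] points, so its indices and coordinates fit into a
    fixed set of registers; abscissas and ordinates use real registers of different parity. *)
Definition load_block (M m : nat) : program :=
  unroll m (fun a =>
    Seq (Instr (ILoad (30 + a) 8 (IAdd (IMul (IReg 20) (IConst M%:Z)) (IConst a%:Z))))
    (Seq (Instr (RLoad (10 + a.*2) 0 (IReg (30 + a))))
         (Instr (RLoad (11 + a.*2) 1 (IReg (30 + a)))))).

(** The machine has no square root, hence squared distances and the bound 4. *)
Definition edge_test (p : nat * nat) : bexp :=
  let dx := RSub (RReg (10 + p.1.*2)) (RReg (10 + p.2.*2)) in
  let dy := RSub (RReg (11 + p.1.*2)) (RReg (11 + p.2.*2)) in
  BLeR (RAdd (RMul dx dx) (RMul dy dy)) (ROfInt (IConst 4)).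

Definition mask_test (m : nat) (a : seq bool) : bexp :=
  ball [seq BNot (edge_test p) | p <- unmarked_pairs m a].

Definition mark_mask (m : nat) (a : seq bool) : program :=
  unroll m (fun x => if nth false a x then Instr (IStore 9 (IReg (30 + x)) (IConst 1)) else Skip).

Definition solve_block (M m : nat) : program :=
  Seq (load_block M m) (chain (mask_test m) (mark_mask m) (masks m)).

(** Unrolled search code needs the block size as a literal, so there is one copy for each size below
    [M], selected at run time by the counter. *)
Definition solve_step (M q s c : nat) : program :=
  Seq (Instr (ILoad 20 5 (IAdd (IMul (IReg 2) (IConst q%:Z)) (IConst (s * 4 + c)%:Z))))
  (Seq (Instr (ILoad 10 7 (IReg 20)))
  (If (BLeI (IConst M%:Z) (IReg 10))
     (Instr (IStore 9 (IReg 2) (IConst 1)))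
     (chain (fun m => ieq (IReg 10) (IConst m%:Z)) (solve_block M) (iota 0 M)))).

Definition solve_loop (M q s : nat) : program :=
  for_loop 2 (IReg 0) (unroll 4 (solve_step M q s)).

Definition count_loop : program :=
  for_loop 2 (IReg 0)
    (Seq (Instr (ILoad 8 9 (IReg 2))) (Instr (ISet 7 (IAdd (IReg 7) (IReg 8))))).

Definition copy_loop : program :=
  for_loop 2 (IReg 0)
    (Seq (Instr (ILoad 8 9 (IReg 2))) (Instr (IStore 0 (IReg 2) (IReg 8)))).

Definition shift_pass (M q s : nat) : program :=
  Seq (fill 7 q 0) (Seq (fill 9 1 0) (Seq (insert_loop M q s) (Seq (solve_loop M q s)
  (Seq (Instr (ISet 7 (IConst 0))) count_loop)))).

Definition one_shift (M q s : nat) : program :=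
  Seq (shift_pass M q s)
  (If (BLeI (IAdd (IReg 7) (IConst 1)) (IReg 9))
     (Seq (Instr (ISet 9 (IReg 7))) copy_loop) Skip).

(** The set of all points is the first candidate, so array 0 holds a cover from the start and a
    shift only has to replace it by a smaller one. *)
Definition all_shifts (M q k : nat) : program :=
  Seq (fill 0 1 1) (Seq (Instr (ISet 9 (IReg 0))) (unroll k (one_shift M q))).

(** * Correctness and cost of the passes over all shifts *)

Section Core.
Variables (R : realType) (N n q M : nat) (ID : nat -> nat -> nat) (X Y : nat -> R).
Hypothesis M_gt0 : (0 < M)%N.
Hypothesis q_gt0 : (0 < q)%N.
Hypothesis N_big : (n * q * M <= N)%N.
Hypothesis ID_lt : forall i w, (i < n)%N -> (w < q)%N -> (ID i w < n * q)%N.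
Implicit Types (st : state R).

Definition close (i j : nat) : bool :=
  (X i - X j) * (X i - X j) + (Y i - Y j) * (Y i - Y j) <= 4%:~R.

Record core_input st : Prop := CoreInput {
  core_n : ireg st 0 = n%:Z;
  core_id i w : (i < n)%N -> (w < q)%N -> iarr st (5%N, (i * q + w)%N) = (ID i w)%:Z;
  core_x i : (i < n)%N -> rarr st (0%N, i) = X i;
  core_y i : (i < n)%N -> rarr st (1%N, i) = Y i }.

Lemma frame_core_input c st st' : frame c st st' -> ~~ writes_ireg c 0 ->
  ~~ writes_iarr c 5 -> ~~ writes_rarr c 0 -> ~~ writes_rarr c 1 ->
  core_input st -> core_input st'.
Proof.
move=> F w1 w2 w3 w4 [h1 h2 h3 h4]; split=> [|i w im wq|i im|i im].
- by rewrite (frame_ireg F).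
- by rewrite (frame_iarr F) // h2.
- by rewrite (frame_rarr F) // h3.
- by rewrite (frame_rarr F) // h4.
Qed.

Let B_N : (n * q <= N)%N. Proof. by apply: leq_trans N_big; rewrite leq_pmulr. Qed.
Let n_N : (n <= N)%N. Proof. by apply: leq_trans B_N; rewrite leq_pmulr. Qed.

Lemma wp_fill a p (v : int) st : ireg st 0 = n%:Z -> (n * p <= N)%N ->
  wp N (fill a p v) (3 * (n * p).+1)
    (fun st' => forall j, (j < n * p)%N -> iarr st' (a, j) = v) st.
Proof.
move=> r0 npN.
apply: (wp_for (I := fun i st' => ireg st' 0 = n%:Z /\
  forall j, (j < i)%N -> iarr st' (a, j) = v) (n := (n * p)%N)).
- by move=> i s [s0 _] _ _ /=; rewrite s0 -PoszM; lia.
- by [].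
- move=> i s [s0 sv] im r2; apply: (@wp_istore _ _ i) => //=; first by lia.
  split=> //; split=> // j ji; rewrite /= xpair_eqE eqxx /=.
  by case: eqP => // ne; apply: sv; lia.
- by move=> s [].
Qed.

Lemma wp_count_loop (V : pred nat) st : ireg st 0 = n%:Z -> ireg st 7 = 0 ->
  (forall j, (j < n)%N -> iarr st (9%N, j) = (V j : nat)%:Z) ->
  wp N count_loop (4 * n.+1) (fun st' => ireg st' 7 = (count V (iota 0 n))%:Z) st.
Proof.
move=> r0 r7 hV.
apply: (wp_for (I := fun i st' => [/\ ireg st' 0 = n%:Z, iarr st' = iarr st &
   ireg st' 7 = (count V (iota 0 i))%:Z]) (n := n)).
- by move=> i st1 [s0 _ _] _ _ /=; rewrite s0; lia.
- by split.
- move=> i st1 [s0 E s7] im r2.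
  apply: (wp_seq (T1 := 1) (T2 := 1)); apply: (@wp_iload _ _ i) => //.
    exact: leq_trans im n_N.
  apply: wp_iset; split=> //; split=> //.
  by rewrite -[i.+1]addn1 iotaD count_cat /= s7 E hV // addn0 add0n.
- by move=> st1 [].
Qed.

Lemma wp_copy_loop (V : pred nat) st : ireg st 0 = n%:Z ->
  (forall j, (j < n)%N -> iarr st (9%N, j) = (V j : nat)%:Z) ->
  wp N copy_loop (4 * n.+1) (fun st' =>
    forall j, (j < n)%N -> iarr st' (0%N, j) = (V j : nat)%:Z) st.
Proof.
move=> r0 hV.
apply: (wp_for (I := fun i st' => [/\ ireg st' 0 = n%:Z,
   forall j, iarr st' (9%N, j) = iarr st (9%N, j) &
   forall j, (j < i)%N -> iarr st' (0%N, j) = (V j : nat)%:Z]) (n := n)).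
- by move=> i st1 [s0 _ _] _ _ /=; rewrite s0; lia.
- by split.
- move=> i st1 [s0 E hj] im r2; have iN := leq_trans im n_N.
  apply: (wp_seq (T1 := 1) (T2 := 1)); apply: (@wp_iload _ _ i) => //.
  apply: (@wp_istore _ _ i) => //; split=> //; split=> // j ji.
  rewrite /= xpair_eqE /= E hV //; case: eqP => [->//|ne].
  by apply: hj; lia.
- by move=> st1 [].
Qed.

Section Shift.
Variable s : nat.
Hypothesis s_q : (s * 4 + 4 <= q)%N.

Definition shift_ids (i : nat) : seq nat := [seq ID i (s * 4 + c)%N | c <- iota 0 4].

Lemma shift_ids_lt i b : (i < n)%N -> b \in shift_ids i -> (b < n * q)%N.
Proof.
move=> im /mapP[c]; rewrite mem_iota add0n => /= c4 ->; apply: ID_lt => //.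
by apply: leq_trans s_q; rewrite ltn_add2l.
Qed.

Lemma take_shift_ids i c : (c < 4)%N ->
  take c.+1 (shift_ids i) = rcons (take c (shift_ids i)) (ID i (s * 4 + c)%N).
Proof. by case: c => [|[|[|[|]]]]. Qed.

Lemma mem_take_shift_ids i c b : (c < 4)%N ->
  (b \in take c (shift_ids i)) = has (fun c' => b == ID i (s * 4 + c')%N) (iota 0 c).
Proof. by case: c => [|[|[|[|]]]] //= _; rewrite !inE ?orbF. Qed.

(** Block [b] once the points before [i] are inserted completely and point [i] through its first [c]
    columns. Testing membership in a prefix, rather than counting occurrences, reflects the skipping
    of repeated names. *)
Definition partial_block (i c b : nat) : seq nat :=
  [seq j <- iota 0 i | b \in shift_ids j] ++
    if b \in take c (shift_ids i) then [:: i] else [::].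

Record insert_inv (i c : nat) st : Prop := InsertInv {
  ins_input : core_input st;
  ins_count b : (b < n * q)%N -> iarr st (7%N, b) = (size (partial_block i c b))%:Z;
  ins_slot b t : (b < n * q)%N -> (t < M)%N -> (t < size (partial_block i c b))%N ->
    iarr st (8%N, (b * M + t)%N) = (nth 0%N (partial_block i c b) t)%:Z }.

Definition insert_regs (i c : nat) st : Prop :=
  ireg st 2 = i%:Z /\ forall c', (c' < c)%N -> ireg st (20 + c')%N = (ID i (s * 4 + c')%N)%:Z.

Lemma slot_lt b t : (b < n * q)%N -> (t < M)%N -> (b * M + t < N)%N.
Proof. by move=> bq tM; apply: leq_trans N_big; nia. Qed.

Lemma wp_insert_step i c st : (i < n)%N -> (c < 4)%N ->
  insert_inv i c st -> insert_regs i c st ->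
  wp N (insert_step M q s c) (ticks (insert_step M q s c))
    (fun st' => insert_inv i c.+1 st' /\ insert_regs i c.+1 st') st.
Proof.
move=> im c4 [hin hc hs] [r2 hr]; apply: wp_ticks => //.
have wq : (s * 4 + c < q)%N by lia.
have iq : (i * q + (s * 4 + c) < N)%N by apply: leq_trans B_N; nia.
apply: wp_seq; apply: (@wp_iload _ _ (i * q + (s * 4 + c))%N); rewrite /= ?r2 //.
rewrite (core_id hin) //.
have bB := ID_lt im wq; set b := ID i (s * 4 + c)%N in bB *.
set st1 := set_ireg _ _ _.
have hr1 c' : (c' < c.+1)%N -> ireg st1 (20 + c')%N = (ID i (s * 4 + c')%N)%:Z.
  by rewrite /= eqn_add2l; case: eqP => [->//|ne] lt; apply: hr; lia.
have hin1 : core_input st1 by case: hin => *; split.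
have test : beval st1 (ball [seq BNot (ieq (IReg (20 + c)) (IReg (20 + c'))) | c' <- iota 0 c])
    = (b \notin take c (shift_ids i)).
  rewrite beval_ball all_map mem_take_shift_ids // -all_predC; apply: eq_in_all => c'.
  rewrite mem_iota add0n /= => c'c; rewrite -eq_le -/(ireg st1 _).
  have -> : (if (20 + c')%N == (20 + c)%N then b%:Z else ireg st (20 + c')%N) = ireg st1 (20 + c')%N by [].
  by rewrite hr1 ?eqxx //; lia.
apply: wp_if; rewrite test => bnew; last first.
  apply: wp_skip; split; last by split.
  have E b' : partial_block i c.+1 b' = partial_block i c b'.
    rewrite /partial_block take_shift_ids // mem_rcons inE.
    by case: eqP => [->|//]; rewrite (negbNE bnew).
  by split=> // [b' b'q|b' t b'q tM]; rewrite E; [apply: hc | apply: hs].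
have sz b' : partial_block i c.+1 b' =
    if b' == b then rcons (partial_block i c b') i else partial_block i c b'.
  rewrite /partial_block take_shift_ids // mem_rcons inE.
  case: eqP => [->|//]; rewrite (negbTE bnew) /=.
  by rewrite cats0 -cats1.
have rb : ireg st1 (20 + c)%N = b%:Z by rewrite hr1.
have b_N : (b < N)%N by apply: leq_trans bB B_N.
apply: wp_seq; apply: (@wp_iload _ _ b); [exact: rb | exact: b_N |].
pose z := size (partial_block i c b).
rewrite (_ : iarr st1 (7%N, b) = z%:Z); last exact: hc.
pose st2 := set_ireg st1 10 z%:Z.
have rb2 : ireg st2 (20 + c)%N = b%:Z by rewrite -rb /st2 /= addSn.
(* When the block is full, nothing is stored, yet the counter still grows; the later comparison with
   [M] relies on the true size. *)
pose mid st3 := [/\ ireg st3 = ireg st2, rarr st3 = rarr st,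
  (forall a j, (a != 8)%N -> iarr st3 (a, j) = iarr st (a, j)),
  (forall b' t, (t < M)%N -> (b', t) != (b, z) ->
     iarr st3 (8%N, (b' * M + t)%N) = iarr st (8%N, (b' * M + t)%N)) &
  (z < M)%N -> iarr st3 (8%N, (b * M + z)%N) = i%:Z].
apply: wp_seq; apply: (@wp_weaken _ _ _ _ _ mid).
- apply: wp_if => /= zM; last by apply: wp_skip; split=> //; move: zM; lia.
  have {}zM : (z < M)%N by move: zM; lia.
  have ad : ireg st2 (20 + c)%N * M%:Z + ireg st2 10 = (b * M + z)%N%:Z by rewrite rb2.
  apply: (@wp_istore _ _ (b * M + z)%N); [exact: ad | exact: slot_lt |].
  have i2 : ireg st2 2 = i%:Z by exact: r2.
  split=> //= [a j a8|b' t tM ne|_].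
  + by rewrite xpair_eqE (negbTE a8).
  + by rewrite xpair_eqE /= address_inj // -xpair_eqE (negbTE ne).
  + by rewrite eqxx.
- by [].
move=> st3 [E1 E2 E3 E4 E5].
apply: (@wp_istore _ _ b) => /=; [by rewrite E1 rb2|done|rewrite E1].
split; last first.
  split=> [|c' c'c] /=; rewrite E1 //.
  by rewrite -(hr1 c') // /st2 /= addSn.
split.
- split=> /= [|j w jn wq'|j jn|j jn]; rewrite ?E1 ?E2; try by case: hin => *; auto.
  by rewrite E3 // (core_id hin).
- move=> b' b'q; rewrite /= xpair_eqE /= sz; case: eqP => [->|_].
    by rewrite size_rcons /st2 /= -addn1.
  by rewrite E3 // hc.
- move=> b' t b'q tM; rewrite /= sz.
  have [->|ne] := eqVneq b' b; last first.
    by move=> /= lt; rewrite E4 // ?hs //; rewrite xpair_eqE (negbTE ne).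
  rewrite size_rcons nth_rcons -/z ltnS leq_eqVlt.
  have [tz|ne] := eqVneq t z; first by subst t => _; rewrite ltnn E5.
  by move=> /= lt; rewrite lt E4 // ?hs //; rewrite xpair_eqE (negbTE ne) andbF.
Qed.

Lemma partial_block4 i b : partial_block i 4 b = partial_block i.+1 0 b.
Proof.
rewrite /partial_block take_oversize ?size_map ?size_iota // take0 in_nil cats0.
by rewrite -[i.+1]addn1 iotaD filter_cat /= add0n.
Qed.

Record grouped st : Prop := Grouped {
  gr_input : core_input st;
  gr_count b : (b < n * q)%N -> iarr st (7%N, b) = (size (block n shift_ids b))%:Z;
  gr_slot b t : (b < n * q)%N -> (t < M)%N -> (t < size (block n shift_ids b))%N ->
    iarr st (8%N, (b * M + t)%N) = (nth 0%N (block n shift_ids b) t)%:Z }.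

Lemma wp_insert_loop st : core_input st ->
  (forall b, (b < n * q)%N -> iarr st (7%N, b) = 0) ->
  wp N (insert_loop M q s) ((ticks (unroll 4 (insert_step M q s))).+2 * n.+1) grouped st.
Proof.
move=> hin h0.
have E b : partial_block n 0 b = block n shift_ids b.
  by rewrite /partial_block take0 cats0.
apply: (wp_for (I := fun i st' => insert_inv i 0 st') (n := n)).
- by move=> i st1 [h _ _] _ _ /=; rewrite (core_n h); lia.
- have E0 b : partial_block 0 0 b = [::] by rewrite /partial_block take0.
  split; first by case: hin => *; split.
    by move=> b bq; rewrite E0; apply: h0.
  by move=> b t _ _; rewrite E0.
- move=> i st1 hi im r2; apply: wp_ticks; first exact: loop_free_unroll.
  apply: wp_weaken (wp_unroll (I := fun c st' => insert_inv i c st' /\ insert_regs i c st')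
     (T := fun c => ticks (insert_step M q s c)) _ _) (leqnn _) _.
  + by split.
  + by move=> c st2 c4 [h1 h2]; apply: wp_insert_step.
  + move=> st2 [[h1 h2 h3] [h4 _]]; split=> //; split.
    * by case: h1 => *; split.
    * by move=> b; rewrite -partial_block4; apply: h2.
    * by move=> b t; rewrite -partial_block4; apply: h3.
- by move=> st1 [h1 h2 h3] _; split=> // [b|b t]; rewrite -E; [apply: h2 | apply: h3].
Qed.

Section Block.
Variables (b : nat) (L : seq nat).
Hypothesis bB : (b < n * q)%N.
Hypothesis L_n : forall j, j \in L -> (j < n)%N.
Hypothesis L_M : (size L <= M)%N.

Let nth_L a : (a < size L)%N -> (nth 0%N L a < n)%N.
Proof. by move=> aL; apply: L_n; rewrite mem_nth. Qed.

Definition loaded (m : nat) st : Prop := forall a, (a < m)%N ->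
  [/\ ireg st (30 + a)%N = (nth 0%N L a)%:Z, rreg st (10 + a.*2)%N = X (nth 0%N L a) &
      rreg st (11 + a.*2)%N = Y (nth 0%N L a)].

(** The time is left existential: [wp_ticks] supplies it once the whole loop-free step is
    assembled. *)
Lemma wp_load_block st : core_input st -> ireg st 20 = b%:Z ->
  (forall t, (t < size L)%N -> iarr st (8%N, (b * M + t)%N) = (nth 0%N L t)%:Z) ->
  exists T, wp N (load_block M (size L)) T
    (fun st' => loaded (size L) st' /\ iarr st' = iarr st) st.
Proof.
move=> hin r20 hs; eexists.
apply: wp_weaken (wp_unroll (I := fun m st' => [/\ loaded m st', iarr st' = iarr st,
   rarr st' = rarr st & ireg st' 20 = b%:Z]) (T := fun=> 3) _ _) (leqnn _) _.
- by split.
- move=> a st1 aL [hl E1 E2 r].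
  have aN : (b * M + a < N)%N by apply: slot_lt => //; apply: leq_trans aL L_M.
  apply: (wp_seq (T1 := 1) (T2 := 2)); apply: (@wp_iload _ _ (b * M + a)%N) => //.
    by rewrite /= r.
  rewrite E1 hs //; set st2 := set_ireg _ _ _.
  have r2 : ireg st2 (30 + a)%N = (nth 0%N L a)%:Z by rewrite /= eqxx.
  have jn := nth_L aL; have jN := leq_trans jn n_N.
  apply: (wp_seq (T1 := 1) (T2 := 1)).
  apply: (@wp_rload _ _ (nth 0%N L a)); [exact: r2 | exact: jN |].
  apply: (@wp_rload _ _ (nth 0%N L a)); [exact: r2 | exact: jN |].
  have Ex : rarr st2 (0%N, nth 0%N L a) = X (nth 0%N L a).
    by rewrite /= E2 (core_x hin).
  have Ey : rarr st2 (1%N, nth 0%N L a) = Y (nth 0%N L a).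
    by rewrite /= E2 (core_y hin).
  rewrite [rarr (set_rreg _ _ _) _](_ : _ = Y (nth 0%N L a)) // Ex.
  split=> // a' a'a; rewrite /= eqn_add2l.
  rewrite (_ : (10 + a'.*2 == 11 + a.*2)%N = false); last by lia.
  rewrite (_ : (10 + a'.*2 == 10 + a.*2)%N = (a' == a)); last by lia.
  rewrite (_ : (11 + a'.*2 == 11 + a.*2)%N = (a' == a)); last by lia.
  rewrite (_ : (11 + a'.*2 == 10 + a.*2)%N = false); last by lia.
  by case: eqP => [->//|ne]; apply: hl; lia.
- by move=> st1 [].
Qed.

Lemma mask_testE st a : loaded (size L) st ->
  beval st (mask_test (size L) a) = mask_ok close L a.
Proof.
move=> hl; rewrite beval_ball all_map; apply: eq_in_all => -[x y].
rewrite mem_unmarked_pairs => /and4P[xy yL _ _] /=.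
have [_ -> ->] := hl x (ltn_trans xy yL); have [_ -> ->] := hl y yL.
by [].
Qed.

Lemma wp_mark_mask st a : loaded (size L) st -> size a = size L ->
  exists T, wp N (mark_mask (size L) a) T (fun st' => forall j,
    iarr st' (9%N, j) = if j \in mask a L then 1 else iarr st (9%N, j)) st.
Proof.
move=> hl sa; eexists.
apply: wp_weaken (wp_unroll (I := fun m st' => ireg st' = ireg st /\ forall j,
    iarr st' (9%N, j) = if has (fun x => nth false a x && (nth 0%N L x == j)) (iota 0 m)
      then 1 else iarr st (9%N, j)) (T := fun=> 1%N) _ _) (leqnn _) _.
- by split.
- move=> x st1 xL [E1 E2].
  have hs j : has (fun x => nth false a x && (nth 0%N L x == j)) (iota 0 x.+1) =
     has (fun x => nth false a x && (nth 0%N L x == j)) (iota 0 x)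
     || nth false a x && (nth 0%N L x == j).
    by rewrite -[x.+1]addn1 iotaD has_cat /= orbF add0n.
  case E: (nth false a x).
    have [r _ _] := hl x xL; have jN := leq_trans (nth_L xL) n_N.
    apply: (@wp_istore _ _ (nth 0%N L x)) => //; first by rewrite /= E1 r.
    split=> // j; rewrite hs E /= xpair_eqE /= E2 eq_sym.
    by case: eqP; rewrite ?orbT ?orbF.
  by apply: wp_skip; split=> // j; rewrite hs E E2 /= orbF.
- by move=> st1 [_ h] j; rewrite h mem_mask_iota.
Qed.

Lemma wp_solve_block st : core_input st -> ireg st 20 = b%:Z ->
  (forall t, (t < size L)%N -> iarr st (8%N, (b * M + t)%N) = (nth 0%N L t)%:Z) ->
  exists T, wp N (solve_block M (size L)) T (fun st' => forall j,
    iarr st' (9%N, j) = if j \in local_cover close L then 1 else iarr st (9%N, j)) st.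
Proof.
move=> hin r20 hs; have [T1 w1] := wp_load_block hin r20 hs.
have lf m : loop_free (mark_mask (size L) m).
  by apply: loop_free_unroll => x; case: ifP.
exists (T1 + (ticks (mark_mask (size L) (local_mask close L)) + size (masks (size L))))%N.
apply: wp_seq; apply: wp_weaken w1 (leqnn _) _ => st1 [hl EA].
apply: (wp_chain (a0 := [::])).
  by rewrite (eq_has (fun a => mask_testE a hl)) has_mask_ok.
rewrite (eq_find (fun a => mask_testE a hl)) -/(local_mask close L).
have [T w] := wp_mark_mask hl (size_local_mask close L).
by apply: wp_ticks (lf _) (wp_weaken w (leqnn _) _) => st2; rewrite EA.
Qed.

End Block.

Definition marked (i c j : nat) : bool :=
  has (fun i' => has (fun b => j \in marks close n M shift_ids i' b) (shift_ids i')) (iota 0 i)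
  || has (fun b => j \in marks close n M shift_ids i b) (take c (shift_ids i)).

Record solve_inv (i c : nat) st : Prop := SolveInv {
  sv_grouped : grouped st;
  sv_loop : ireg st 2 = i%:Z;
  sv_marked j : (j < n)%N -> iarr st (9%N, j) = (marked i c j : nat)%:Z }.

Lemma loop_free_solve_step c : loop_free (solve_step M q s c).
Proof.
rewrite /= ; apply: loop_free_chain => m /=; apply/andP; split.
  exact: loop_free_unroll.
by apply: loop_free_chain => a; apply: loop_free_unroll => x; case: ifP.
Qed.

Lemma frame_grouped c st st' : frame c st st' -> ~~ writes_ireg c 0 ->
  ~~ writes_iarr c 5 -> ~~ writes_rarr c 0 -> ~~ writes_rarr c 1 ->
  ~~ writes_iarr c 7 -> ~~ writes_iarr c 8 -> grouped st -> grouped st'.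
Proof.
move=> F w1 w2 w3 w4 w5 w6 [h1 h2 h3]; split=> [|b bq|b t bq tM tb].
- exact: frame_core_input F w1 w2 w3 w4 h1.
- by rewrite (frame_iarr F) // h2.
- by rewrite (frame_iarr F) // h3.
Qed.

(** For symbolic [M] the lists of masks and copies do not compute, so the write set is bounded
    through the kinds of instructions that can occur, for all four notions of writing at once. *)
Lemma solve_step_writes w c x :
  ~~ w (ILoad 20 5 (IAdd (IMul (IReg 2) (IConst q%:Z)) (IConst (s * 4 + c)%:Z))) x ->
  ~~ w (ILoad 10 7 (IReg 20)) x -> ~~ w (IStore 9 (IReg 2) (IConst 1)) x ->
  (forall a, ~~ w (ILoad (30 + a) 8 (IAdd (IMul (IReg 20) (IConst M%:Z)) (IConst a%:Z))) x) ->
  (forall a, ~~ w (RLoad (10 + a.*2) 0 (IReg (30 + a))) x) ->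
  (forall a, ~~ w (RLoad (11 + a.*2) 1 (IReg (30 + a))) x) ->
  (forall a, ~~ w (IStore 9 (IReg (30 + a)) (IConst 1)) x) ->
  ~~ writes w (solve_step M q s c) x.
Proof.
move=> h1 h2 h3 h4 h5 h6 h7 /=; rewrite !negb_or h1 h2 h3 /=.
apply: writes_chainF => m /=; rewrite negb_or; apply/andP; split.
  by apply: writes_unrollF => a /=; rewrite !negb_or h4 h5 h6.
by apply: writes_chainF => a; apply: writes_unrollF => x'; case: ifP => /=.
Qed.

Lemma wp_solve_step i c st : (i < n)%N -> (c < 4)%N -> solve_inv i c st ->
  wp N (solve_step M q s c) (ticks (solve_step M q s c)) (solve_inv i c.+1) st.
Proof.
move=> im c4 [hg r2 hm].
have wq : (s * 4 + c < q)%N by lia.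
have iq : (i * q + (s * 4 + c) < N)%N by apply: leq_trans B_N; nia.
have bB := ID_lt im wq; pose b := ID i (s * 4 + c)%N.
set ms := marks close n M shift_ids.
have mk j : marked i c.+1 j = (j \in ms i b) || marked i c j.
  by rewrite /marked take_shift_ids // has_rcons orbCA.
(* Only array 9 requires an argument; the other clauses of the invariant follow from the frame. *)
suff [T w] : exists T, wp N (solve_step M q s c) T (fun st' => forall j, (j < n)%N ->
    iarr st' (9%N, j) = if j \in ms i b then 1 else iarr st (9%N, j)) st.
  apply: wp_ticks; first exact: loop_free_solve_step.
  apply: wp_frame; apply: wp_weaken w (leqnn _) _ => st' h F; split.
  - by apply: frame_grouped F _ _ _ _ _ _ hg; apply: solve_step_writes.
  - by rewrite (frame_ireg F) //; apply: solve_step_writes.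
  - by move=> j jn; rewrite h // hm // mk; case: ifP.
set L := block n shift_ids b.
pose st2 := set_ireg (set_ireg st 20 b%:Z) 10 (size L)%:Z.
have test m : beval st2 (ieq (IReg 10) (IConst m%:Z)) = (size L == m).
  by rewrite beval_ieq.
suff [T w] : exists T, wp N (If (BLeI (IConst M%:Z) (IReg 10))
     (Instr (IStore 9 (IReg 2) (IConst 1)))
     (chain (fun m => ieq (IReg 10) (IConst m%:Z)) (solve_block M) (iota 0 M))) T
     (fun st' => forall j, (j < n)%N ->
        iarr st' (9%N, j) = if j \in ms i b then 1 else iarr st (9%N, j)) st2.
  exists (1 + (1 + T))%N.
  apply: wp_seq; apply: (@wp_iload _ _ (i * q + (s * 4 + c))%N) => //.
    by rewrite /= r2.
  rewrite (core_id (gr_input hg)) // -/b.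
  apply: wp_seq; apply: (@wp_iload _ _ b) => //; first exact: leq_trans bB B_N.
  by rewrite [iarr (set_ireg _ _ _) _](gr_count hg).
rewrite /ms /marks -/L.
have [big|small] := leqP M (size L).
  exists (maxn 1 0).+1; apply: wp_if => /=; last by rewrite lez_nat big.
  move=> _; apply: (@wp_istore _ _ i) => //; first exact: leq_trans im n_N.
  by move=> j jn; rewrite /= xpair_eqE /= mem_seq1.
have hin2 : core_input st2 by case: (gr_input hg) => *; split.
have L_n j : j \in L -> (j < n)%N by rewrite mem_block => /andP[].
have hslot t : (t < size L)%N -> iarr st2 (8%N, (b * M + t)%N) = (nth 0%N L t)%:Z.
  by move=> tL; apply: (gr_slot hg) => //; apply: ltn_trans tL small.
have [T w] := wp_solve_block bB L_n (ltnW small) hin2 erefl hslot.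
exists (maxn 0 (T + size (iota 0 M))).+1; apply: wp_if => /=.
  by rewrite lez_nat leqNgt small.
move=> _; apply: (wp_chain (a0 := 0%N)).
  by apply/hasP; exists (size L); rewrite ?mem_iota // test.
rewrite (eq_find test) (_ : nth _ _ _ = size L).
  by apply: wp_weaken w (leqnn _) _ => st' h j jn; rewrite h.
have -> : find (fun m => size L == m) (iota 0 M) = index (size L) (iota 0 M).
  by apply: eq_find => m; rewrite eq_sym.
by rewrite nth_index // mem_iota.
Qed.

Lemma wp_solve_loop st : grouped st -> (forall j, (j < n)%N -> iarr st (9%N, j) = 0) ->
  wp N (solve_loop M q s) ((ticks (unroll 4 (solve_step M q s))).+2 * n.+1) (fun st' =>
    grouped st' /\ forall j, (j < n)%N ->
      iarr st' (9%N, j) = (shift_cover close n M shift_ids j : nat)%:Z) st.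
Proof.
move=> hg h0.
apply: (wp_for (I := fun i st' => grouped st' /\ forall j, (j < n)%N ->
   iarr st' (9%N, j) = (marked i 0 j : nat)%:Z) (n := n)).
- by move=> i st1 [[h _ _] _] _ _ /=; rewrite (core_n h); lia.
- split; first by case: hg => -[*] *; split=> //; split.
  by move=> j jn; rewrite /marked take0; apply: h0.
- move=> i st1 [hg1 hm] im r2; apply: wp_ticks.
    by apply: loop_free_unroll => c; apply: loop_free_solve_step.
  apply: wp_weaken (wp_unroll (I := solve_inv i)
     (T := fun c => ticks (solve_step M q s c)) _ _) (leqnn _) _.
  + by split.
  + by move=> c st2 c4; apply: wp_solve_step.
  + move=> st2 [h1 h2 h3]; split=> //; split.
      by case: h1 => -[*] *; split=> //; split.
    move=> j jn; rewrite [LHS]h3 // /marked take_oversize ?size_map ?size_iota //.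
    by rewrite take0 has_nil orbF -[i.+1]addn1 iotaD has_cat has_seq1.
- by move=> st1 [h1 h2] _; split=> // j jn; rewrite h2 // /marked take0 has_nil orbF.
Qed.

Definition shift_pass_cost : nat := (3 * q + ticks (unroll 4 (insert_step M q s))
  + ticks (unroll 4 (solve_step M q s)) + 12)%N.

Lemma wp_shift_pass st : core_input st ->
  wp N (shift_pass M q s) (shift_pass_cost * n.+1) (fun st' =>
    [/\ core_input st', ireg st' 7 = (count (shift_cover close n M shift_ids) (iota 0 n))%:Z &
        forall j, (j < n)%N ->
          iarr st' (9%N, j) = (shift_cover close n M shift_ids j : nat)%:Z]) st.
Proof.
move=> hin; set V := shift_cover _ _ _ _; set Q := (fun st' => _).
set A := ticks (unroll 4 (insert_step M q s)); set B := ticks (unroll 4 (solve_step M q s)).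
apply: (@wp_weaken _ _ _ (3 * (n * q).+1 + (3 * (n * 1).+1 + (A.+2 * n.+1 +
  (B.+2 * n.+1 + (1 + 4 * n.+1))))) _ Q); [|rewrite /shift_pass_cost -/A -/B; nia|by []].
apply: wp_seq; apply: wp_frame; apply: wp_weaken (wp_fill 7 0 (core_n hin) B_N) (leqnn _) _.
move=> st1 h7 F1; have in1 := frame_core_input F1 isT isT isT isT hin.
have n1N : (n * 1 <= N)%N by rewrite muln1.
apply: wp_seq; apply: wp_frame; apply: wp_weaken (wp_fill 9 0 (core_n in1) n1N) (leqnn _) _.
move=> st2 h9 F2; have in2 := frame_core_input F2 isT isT isT isT in1.
have h72 b : (b < n * q)%N -> iarr st2 (7%N, b) = 0 by move=> bq; rewrite (frame_iarr F2) // h7.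
apply: wp_seq; apply: wp_frame; apply: wp_weaken (wp_insert_loop in2 h72) (leqnn _) _.
move=> st3 g3 F3.
have h93 j : (j < n)%N -> iarr st3 (9%N, j) = 0.
  by move=> jn; rewrite (frame_iarr F3) // h9 // muln1.
apply: wp_seq; apply: wp_weaken (wp_solve_loop g3 h93) (leqnn _) _ => st4 [[in4 _ _] h94].
apply: wp_seq; apply: wp_iset; set st5 := set_ireg _ _ _.
have in5 : core_input st5 by case: in4 => *; split.
apply: wp_frame; apply: wp_weaken (wp_count_loop (core_n in5) erefl h94) (leqnn _) _.
move=> st6 h7' F6; split=> //; first exact: frame_core_input F6 isT isT isT isT in5.
by move=> j jn; rewrite (frame_iarr F6) // h94.
Qed.

Lemma shift_pass_writes w x :
  (forall e, ~~ w (ISet 2 e) x) -> (forall e, ~~ w (ISet 7 e) x) ->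
  (forall y a e, (2 < y)%N -> y != 9 -> ~~ w (ILoad y a e) x) ->
  (forall y a e, ~~ w (RLoad y a e) x) ->
  (forall a e v, (2 < a)%N -> ~~ w (IStore a e v) x) ->
  ~~ writes w (shift_pass M q s) x.
Proof.
move=> h1 h2 h3 h4 h5.
have solve c : ~~ writes w (solve_step M q s c) x.
  apply: solve_step_writes; [exact: h3|exact: h3|exact: h5| |move=> a; exact: h4|
    move=> a; exact: h4|move=> a; exact: h5].
  by move=> a; apply: h3; lia.
rewrite /shift_pass /solve_loop.
have: ~~ writes w (unroll 4 (solve_step M q s)) x by apply: writes_unrollF.
set U := unroll 4 (solve_step M q s); clearbody U => wU.
by rewrite /= !negb_or wU !h1 !h2 !h5 // !h3.
Qed.

End Shift.

Section Shifts.
Variable k : nat.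
Hypothesis k_q : (k * 4 <= q)%N.
Let cover s := shift_cover close n M (shift_ids s).
Hypothesis cover_ok : forall s, (s < k)%N -> covers close (iota 0 n) (cover s).

Record best_inv (s : nat) st : Prop := BestInv {
  best_input : core_input st;
  best_cover : exists V : pred nat, [/\ covers close (iota 0 n) V,
    forall j, (j < n)%N -> iarr st (0%N, j) = (V j : nat)%:Z,
    ireg st 9 = (count V (iota 0 n))%:Z &
    forall s', (s' < s)%N -> (count V (iota 0 n) <= count (cover s') (iota 0 n))%N] }.

Lemma wp_one_shift s st : (s < k)%N -> best_inv s st ->
  wp N (one_shift M q s) ((shift_pass_cost s).+4.+3 * n.+1) (best_inv s.+1) st.
Proof.
move=> sk [hin [V [cV hV r9 hs]]].
have s_q : (s * 4 + 4 <= q)%N by lia.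
apply: (@wp_weaken _ _ _ (shift_pass_cost s * n.+1 + (maxn (1 + 4 * n.+1) 1).+1) _ (best_inv s.+1));
  [|nia|by []].
apply: wp_seq; apply: wp_frame; apply: wp_weaken (wp_shift_pass s_q hin) (leqnn _) _.
move=> st1 [in1 r7 h9] F.
have r91 : ireg st1 9 = (count V (iota 0 n))%:Z.
  rewrite (frame_ireg F) //; apply: shift_pass_writes => //= y a e _; rewrite eq_sym => ->; exact: isT.
have hV1 j : (j < n)%N -> iarr st1 (0%N, j) = (V j : nat)%:Z.
  by move=> jn; rewrite (frame_iarr F) ?hV //; apply: shift_pass_writes => //= -[].
apply: wp_if => /=; rewrite r7 r91 => hlt.
  apply: wp_seq; apply: wp_iset; set st2 := set_ireg _ _ _.
  have in2 : core_input st2 by case: in1 => *; split.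
  apply: wp_frame; apply: wp_weaken (wp_copy_loop (core_n in2) h9) (leqnn _) _ => st3 h0 F3.
  split; first exact: frame_core_input F3 isT isT isT isT in2.
  exists (cover s); split=> //; first exact: cover_ok.
    by rewrite (frame_ireg F3).
  move=> s'; rewrite ltnS leq_eqVlt => /predU1P[->//|lt].
  apply: leq_trans (hs s' lt); move: hlt; rewrite /cover; lia.
apply: wp_skip; split=> //; exists V; split=> // s'.
rewrite ltnS leq_eqVlt => /predU1P[->|lt]; last exact: hs.
by move: hlt; rewrite /cover; lia.
Qed.

Definition all_shifts_cost : nat := (\sum_(s <- iota 0 k) (shift_pass_cost s).+4.+3 + 5)%N.

Lemma wp_all_shifts st : core_input st ->
  wp N (all_shifts M q k) (all_shifts_cost * n.+1) (best_inv k) st.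
Proof.
move=> hin; set S := (\sum_(s <- iota 0 k) (shift_pass_cost s).+4.+3)%N.
apply: (@wp_weaken _ _ _ (3 * (n * 1).+1 + (1 + (S * n.+1 + 1))) _ (best_inv k));
  [|by rewrite /all_shifts_cost -/S; nia|by []].
have n1N : (n * 1 <= N)%N by rewrite muln1.
apply: wp_seq; apply: wp_frame; apply: wp_weaken (wp_fill 0 1 (core_n hin) n1N) (leqnn _) _.
move=> st1 h0 F1; have in1 := frame_core_input F1 isT isT isT isT hin.
apply: wp_seq; apply: wp_iset; rewrite /S big_distrl /=.
apply: (wp_unroll (I := best_inv) (T := fun s => ((shift_pass_cost s).+4.+3 * n.+1)%N)).
  split; first by case: in1 => *; split.
  exists predT; split=> //; first by move=> i j _ _ _ _; left.
    by move=> j jn; rewrite /= h0 // muln1.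
  by rewrite /= (core_n in1) count_predT size_iota.
by move=> s st2 sk; apply: wp_one_shift.
Qed.

End Shifts.
End Core.

(** * Geometry of the shifted blocks *)

(* Column [w = 4 s + 2 e + f] of the identifier table belongs to shift [s]; in each
   coordinate a point also belongs to the preceding block when it lies within distance 2
   of the border, and the bits [e], [f] select that second block.  The summand 2 keeps
   the truncated subtraction honest. *)
Definition offset_x (w : nat) : nat := (w %/ 4 + 2 - ((w %% 4)./2).*2)%N.
Definition offset_y (w : nat) : nat := (w %/ 4 + 2 - (odd w).*2)%N.

Definition block_key (k : nat) (u v : int) (w : nat) : int * int :=
  (((u + (offset_x w)%:Z) %/ k)%Z, ((v + (offset_y w)%:Z) %/ k)%Z).

Lemma offset_xE s (e f : bool) : offset_x (s * 4 + (e.*2 + f)) = (s + 2 - e.*2)%N.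
Proof. by rewrite /offset_x divnMDl // modnMDl; case: e; case: f; rewrite addn0. Qed.

Lemma offset_yE s (e f : bool) : offset_y (s * 4 + (e.*2 + f)) = (s + 2 - f.*2)%N.
Proof.
by rewrite /offset_y divnMDl // !oddD !oddM !odd_double andbF; case: e; case: f; rewrite addn0.
Qed.

(** Telescoping with step two leaves two terms at each end. *)
Lemma sum_skip (f : nat -> int) m :
  \sum_(s < m) (f s.+2 - f s) = f m.+1 + f m - f 1%N - f 0%N.
Proof. by elim: m => [|m IH]; rewrite ?big_ord0 ?big_ord_recr /= ?IH; lia. Qed.

Section FloorBlocks.
Variable k : nat.
Hypothesis k_ge2 : (2 <= k)%N.

Let k0 : k%:Z != 0. Proof. by lia. Qed.

(** Let [u <= v]. Then [u + s + 2] lies in the window from [v + s] to [v + s + 2]. The window has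
    length 2, at most [k], so its points have at most the two quotients of its ends, and these are
    the two blocks of [v]. *)
Lemma near_common_block (u v : int) (s : nat) : u - v <= 2 -> v - u <= 2 ->
  exists e e' : bool, ((u + (s + 2 - e.*2)%N%:Z) %/ k)%Z = ((v + (s + 2 - e'.*2)%N%:Z) %/ k)%Z.
Proof.
wlog uv : u v / u <= v => [th h1 h2|_ h].
  have [le|lt] := leP u v; first exact: th.
  by have [e [e' E]] := th v u (ltW lt) h2 h1; exists e', e.
have mono (x y : int) : x <= y -> ((x %/ k)%Z <= (y %/ k)%Z)%R by apply: lez_pdiv2r.
have step (x : int) : ((x + k%:Z) %/ k)%Z = (x %/ k)%Z + 1.
  by have := divzMDl 1 x k0; rewrite mul1r addrC => ->; rewrite addrC.
exists false; set a := u + _.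
have b2 : v + (s + 2 - true.*2)%N%:Z <= a by rewrite /a /=; lia.
have b0 : a <= v + (s + 2 - false.*2)%N%:Z by rewrite /a /=; lia.
have b1 : v + (s + 2 - false.*2)%N%:Z <= v + (s + 2 - true.*2)%N%:Z + k%:Z by lia.
have := mono _ _ b2; have := mono _ _ b0; have := mono _ _ b1; rewrite step => h3 h4 h5.
have [E|ne] := eqVneq (a %/ k)%Z ((v + (s + 2 - true.*2)%N%:Z) %/ k)%Z; first by exists true.
by exists false; lia.
Qed.

Definition straddles (u : int) (s : nat) : bool :=
  ((u + s.+2%:Z) %/ k)%Z != ((u + s%:Z) %/ k)%Z.

(** A straddling shift is one where the quotient grows between [s] and [s + 2]. Over a full period
    these increments telescope to exactly 2, because adding [k] raises the quotient by 1. *)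
Lemma sum_straddles u : (\sum_(s < k) straddles u s <= 2)%N.
Proof.
pose f (s : nat) : int := ((u + s%:Z) %/ k)%Z.
have step (s : nat) : f (k + s)%N = f s + 1.
  rewrite /f PoszD addrCA; have := divzMDl 1 (u + s%:Z) k0.
  by rewrite mul1r => ->; rewrite addrC.
have le : (\sum_(s < k) straddles u s)%N%:Z <= \sum_(s < k) (f s.+2 - f s).
  apply: (big_ind2 (fun (x : nat) (y : int) => x%:Z <= y)) => [//|x1 x2 y1 y2|s _].
    by rewrite PoszD; apply: lerD.
  have := @lez_pdiv2r k%:Z isT (u + s%:Z) (u + s.+2%:Z) _.
  rewrite -/(f s) -/(f s.+2) /straddles -/(f s) -/(f s.+2); lia.
rewrite -lez_nat; apply: le_trans le _; rewrite sum_skip.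
by have := step 1%N; have := step 0%N; rewrite addn0 addn1; lia.
Qed.

End FloorBlocks.

(** * Overlap and independence bounds for the blocks *)

Section ShiftBounds.
Variables (R : realType) (n k : nat) (ID : nat -> nat -> nat) (X Y : nat -> R).
Variables (cx cy : nat -> int).
Hypothesis k_ge2 : (2 <= k)%N.
Hypothesis same_cell : forall i j, (i < n)%N -> (j < n)%N ->
  cx i = cx j -> cy i = cy j -> close X Y i j.
Hypothesis near_cells : forall i j, (i < n)%N -> (j < n)%N -> close X Y i j ->
  [/\ cx i - cx j <= 2, cx j - cx i <= 2, cy i - cy j <= 2 & cy j - cy i <= 2].
Hypothesis IDP : forall i j w w', (i < n)%N -> (j < n)%N -> (w < k * 4)%N -> (w' < k * 4)%N ->
  (ID i w = ID j w' <-> block_key k (cx i) (cy i) w = block_key k (cx j) (cy j) w').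

Lemma close_sym : symmetric (close X Y).
Proof. by move=> i j; rewrite /close; congr (_ <= _); ring. Qed.

Lemma mem_shift_ids (e f : bool) i s : ID i (s * 4 + (e.*2 + f))%N \in shift_ids ID s i.
Proof. by apply/mapP; exists (e.*2 + f)%N; rewrite // mem_iota; case: e; case: f. Qed.

Lemma shift_idsP i s b : b \in shift_ids ID s i ->
  exists e f : bool, b = ID i (s * 4 + (e.*2 + f))%N.
Proof.
case/mapP => -[|[|[|[|c]]]] _ -> //.
- by exists false, false.
- by exists false, true.
- by exists true, false.
- by exists true, true.
Qed.

Lemma column_lt s (e f : bool) : (s < k)%N -> (s * 4 + (e.*2 + f) < k * 4)%N.
Proof. by case: e; case: f => /=; lia. Qed.

Lemma close_common_block s i j : (s < k)%N -> (i < n)%N -> (j < n)%N -> close X Y i j ->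
  exists2 b, b \in shift_ids ID s i & b \in shift_ids ID s j.
Proof.
move=> sk im jn cij; have [h1 h2 h3 h4] := near_cells im jn cij.
have [e [e' Ex]] := near_common_block k_ge2 s h1 h2.
have [f [f' Ey]] := near_common_block k_ge2 s h3 h4.
exists (ID i (s * 4 + (e.*2 + f))%N); first exact: mem_shift_ids.
have -> : ID i (s * 4 + (e.*2 + f))%N = ID j (s * 4 + (e'.*2 + f'))%N.
  by apply/IDP => //; rewrite ?column_lt // /block_key !offset_xE !offset_yE Ex Ey.
exact: mem_shift_ids.
Qed.

(** A point has one block if it straddles in neither coordinate and at most [4 = 1 + 3] otherwise.
    Each coordinate straddles for at most two shifts, whence the excess [3 * (2 + 2) = 12]. *)
Lemma sum_size_shift_ids i : (i < n)%N ->
  (\sum_(s < k) size (undup (shift_ids ID s i)) <= k + 12)%N.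
Proof.
move=> im.
have le s : (s < k)%N -> (size (undup (shift_ids ID s i)) <=
    1 + 3 * (straddles k (cx i) s + straddles k (cy i) s))%N.
  move=> sk; have [sx|/negbNE/eqP Ex] := boolP (straddles k (cx i) s).
    by apply: leq_trans (size_undup _) _; rewrite size_map size_iota; lia.
  have [sy|/negbNE/eqP Ey] := boolP (straddles k (cy i) s).
    by apply: leq_trans (size_undup _) _; rewrite size_map size_iota; lia.
  apply: (@uniq_leq_size _ _ [:: ID i (s * 4 + 0)%N] (undup_uniq _)) => b.
  rewrite mem_undup mem_seq1 => /shift_idsP[e [f ->]]; apply/eqP/IDP => //.
  - exact: column_lt.
  - exact: (column_lt false false).
  rewrite /block_key (offset_xE s e f) (offset_yE s e f).
  rewrite (offset_xE s false false) (offset_yE s false false).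
  have sub (h : bool) : (s + 2 - h.*2)%N = if h then s else s.+2 by case: h => /=; lia.
  by rewrite !sub; case: e; case: f; rewrite ?Ex ?Ey.
have le_sum : (\sum_(s < k) size (undup (shift_ids ID s i)) <=
    \sum_(s < k) (1 + 3 * (straddles k (cx i) s + straddles k (cy i) s)))%N.
  by apply: leq_sum => s _; apply: le.
apply: leq_trans le_sum _.
rewrite big_split sum_nat_const card_ord muln1 /= -big_distrr big_split /=.
by rewrite leq_add2l (leq_mul2l 3 _ (2 + 2)) leq_add // sum_straddles.
Qed.

(** Points outside a cover are pairwise not close, so no two of them share a cell; it remains to
    count the cells of an enlarged block, numbered by [code]. *)
Lemma block_uncovered s (W : pred nat) b : (s < k)%N -> covers (close X Y) (iota 0 n) W ->
  (count (predC W) (block n (shift_ids ID s) b) <= (k + 2) * (k + 2))%N.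
Proof.
move=> sk cW; set L := [seq i <- block n (shift_ids ID s) b | predC W i].
rewrite -size_filter -/L.
case EL: L => [//|i0 L']; have memL i : i \in L -> [/\ (i < n)%N, b \in shift_ids ID s i & ~~ W i].
  by rewrite mem_filter mem_block => /and3P[].
have [i0n /shift_idsP[e0 [f0 Eb]] _] : [/\ (i0 < n)%N, b \in shift_ids ID s i0 & ~~ W i0].
  by apply: memL; rewrite EL mem_head.
rewrite -EL {EL L'}.
set key0 := block_key k (cx i0) (cy i0) (s * 4 + (e0.*2 + f0)).
pose u i := cx i + s.+2%:Z - key0.1 * k%:Z; pose v i := cy i + s.+2%:Z - key0.2 * k%:Z.
(* The offset [s + 2] yields positions from 0 to [k - 1], the offset [s] positions from 2 to
   [k + 1]: together a side of [k + 2] cells. *)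
have range (x : int) (h : bool) a : ((x + (s + 2 - h.*2)%N%:Z) %/ k)%Z = a ->
    0 <= x + s.+2%:Z - a * k%:Z < k%:Z + 2.
  move=> <-; have kk0 : k%:Z != 0 by lia.
  have kk1 : (0 : int) < k%:Z by lia.
  have := lez_floor (x + (s + 2 - h.*2)%N%:Z) kk0.
  have := ltz_ceil (x + (s + 2 - h.*2)%N%:Z) kk1; rewrite mulrDl mul1r.
  by case: h => /=; lia.
have uv i : i \in L -> (0 <= u i < k%:Z + 2) /\ (0 <= v i < k%:Z + 2).
  move=> /memL[im /shift_idsP[e [f Ei]] _].
  have Ek := proj1 (IDP i0n im (column_lt e0 f0 sk) (column_lt e f sk)) (etrans (esym Eb) Ei).
  rewrite -/key0 in Ek.
  rewrite /u /v Ek /block_key offset_xE offset_yE /=; split; exact: range.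
pose code i := (`|u i| * (k + 2) + `|v i|)%N.
have inj : {in L &, injective code}.
  move=> i j iL jL; rewrite /code => E.
  have [/andP[u1 u2] /andP[v1 v2]] := uv i iL; have [/andP[u3 u4] /andP[v3 v4]] := uv j jL.
  have vi : (`|v i| < k + 2)%N by lia.
  have vj : (`|v j| < k + 2)%N by lia.
  move/eqP: E; rewrite address_inj // => /andP[/eqP Eu /eqP Ev].
  have Ecx : cx i = cx j by move: Eu u1 u3; rewrite /u; lia.
  have Ecy : cy i = cy j by move: Ev v1 v3; rewrite /v; lia.
  have [im _ Wi] := memL i iL; have [jn _ Wj] := memL j jL.
  apply/eqP/negPn/negP => ne; have cij := same_cell im jn Ecx Ecy.
  have := cW i j; rewrite !mem_iota im jn => /(_ isT isT ne cij).
  by case=> h; rewrite h in Wi Wj.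
rewrite -(size_map code) -[leqRHS](size_iota 0); apply: uniq_leq_size.
  by rewrite map_inj_in_uniq // !filter_uniq // iota_uniq.
move=> c /mapP[i iL ->]; have [/andP[u1 u2] /andP[v1 v2]] := uv i iL.
have vi : (`|v i| < k + 2)%N by lia.
have ui : (`|u i| < k + 2)%N by lia.
by rewrite mem_iota add0n leq0n /= /code; nia.
Qed.

End ShiftBounds.

(** * Block identifiers *)

(** An absent key reads as 0, so stored names start at 1 and the identifier is the name minus 1.
    Integer division by [k] is the floor of a real quotient; register 8 counts the names issued. *)
Definition hash_step (k w : nat) : program :=
  Seq (Instr (Floor 5 (RDiv (ROfInt (IAdd (IReg 3) (IConst (offset_x w)%:Z))) (ROfInt (IConst k%:Z)))))
  (Seq (Instr (Floor 6 (RDiv (ROfInt (IAdd (IReg 4) (IConst (offset_y w)%:Z))) (ROfInt (IConst k%:Z)))))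
  (Seq (Instr (HLoad 7 0 (IReg 5) (IReg 6)))
  (Seq (If (BLeI (IReg 7) (IConst 0))
           (Seq (Instr (ISet 8 (IAdd (IReg 8) (IConst 1))))
           (Seq (Instr (ISet 7 (IReg 8))) (Instr (HStore 0 (IReg 5) (IReg 6) (IReg 7)))))
           Skip)
       (Instr (IStore 5 (IAdd (IMul (IReg 2) (IConst (k * 4)%N%:Z)) (IConst w%:Z))
                        (ISub (IReg 7) (IConst 1))))))).

Definition hash_body (k : nat) : program :=
  Seq (Instr (RLoad 0 0 (IReg 2)))
  (Seq (Instr (Floor 3 (RReg 0)))
  (Seq (Instr (RLoad 1 1 (IReg 2)))
  (Seq (Instr (Floor 4 (RReg 1)))
       (unroll (k * 4) (hash_step k))))).

Definition hash_ids (k : nat) : program := for_loop 2 (IReg 0) (hash_body k).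

(** Division by the constant [k] is tabulated by counting, with the remainder in register 4. The
    length leaves room for a cluster number below [n] plus an offset. *)
Definition div_table (k : nat) : program :=
  Seq (Instr (ISet 3 (IConst 0))) (Seq (Instr (ISet 4 (IConst 0)))
  (for_loop 2 (IAdd (IReg 0) (IConst (k + 3)%N%:Z))
    (Seq (Instr (IStore 6 (IReg 2) (IReg 3)))
    (Seq (Instr (ISet 4 (IAdd (IReg 4) (IConst 1))))
    (If (BLeI (IConst k%:Z) (IReg 4))
      (Seq (Instr (ISet 3 (IAdd (IReg 3) (IConst 1)))) (Instr (ISet 4 (IConst 0))))
      Skip))))).

(** A pair of block coordinates becomes one number in radix [n + k + 3], stored as a real so that
    the clustering program can serve as a naming procedure. *)
Definition key_step (k w : nat) : program :=
  Seq (Instr (ILoad 5 6 (IAdd (IReg 3) (IConst (offset_x w)%:Z))))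
  (Seq (Instr (ILoad 6 6 (IAdd (IReg 4) (IConst (offset_y w)%:Z))))
  (Instr (RStore 2 (IAdd (IMul (IReg 2) (IConst (k * 4)%N%:Z)) (IConst w%:Z))
     (ROfInt (IAdd (IMul (IReg 5) (IAdd (IReg 0) (IConst (k + 3)%N%:Z))) (IReg 6)))))).

Definition key_body (k : nat) : program :=
  Seq (Instr (ILoad 3 3 (IReg 2))) (Seq (Instr (ILoad 4 4 (IReg 2))) (unroll (k * 4) (key_step k))).

Definition key_loop (k : nat) : program := for_loop 2 (IReg 0) (key_body k).

(** The first two clusterings leave the cells in arrays 3 and 4; the third, over all columns of all
    points, writes its numbers into array 5, where the later passes expect the identifiers. *)
Definition plain_ids (k : nat) : program :=
  Seq (Instr (ISet 1 (IReg 0))) (Seq (cluster 0 0 1) (Seq (cluster 1 1 1)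
  (Seq (div_table k) (Seq (key_loop k)
  (Seq (Instr (ISet 1 (IMul (IReg 0) (IConst (k * 4)%N%:Z)))) (cluster 2 2 0)))))).

Lemma floor_divz (R : realType) (a : int) (k : nat) : (0 < k)%N ->
  Num.floor (a%:~R / k%:Z%:~R : R) = (a %/ k)%Z.
Proof.
move=> k0; apply: floor_def.
have kR : (0 : R) < k%:Z%:~R by rewrite ltr0z; lia.
rewrite ler_pdivlMr // ltr_pdivrMr // -!intrM ler_int ltr_int lez_floor; last by lia.
by rewrite ltz_ceil //; lia.
Qed.

(** * Correctness of both naming procedures *)

Section Identifiers.
Variables (R : realType) (N n k : nat) (X Y : nat -> R).
Hypothesis k_gt0 : (0 < k)%N.
Implicit Types (st : state R).

Record points_input st : Prop := PointsInput {
  pt_n : ireg st 0 = n%:Z;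
  pt_x i : (i < n)%N -> rarr st (0%N, i) = X i;
  pt_y i : (i < n)%N -> rarr st (1%N, i) = Y i }.

(** The interface between naming and covering. The cells are existential, since one machine takes
    floors of coordinates and the other cluster numbers. *)
Definition identified st : Prop := exists (cx cy : nat -> int) (ID : nat -> nat -> nat),
  [/\ core_input n (k * 4) ID X Y st,
      forall i w, (i < n)%N -> (w < k * 4)%N -> (ID i w < n * (k * 4))%N,
      forall i j, (i < n)%N -> (j < n)%N -> cx i = cx j -> cy i = cy j -> close X Y i j,
      forall i j, (i < n)%N -> (j < n)%N -> close X Y i j ->
        [/\ cx i - cx j <= 2, cx j - cx i <= 2, cy i - cy j <= 2 & cy j - cy i <= 2] &
      forall i j w w', (i < n)%N -> (j < n)%N -> (w < k * 4)%N -> (w' < k * 4)%N ->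
        (ID i w = ID j w' <->
         block_key k (cx i) (cy i) w = block_key k (cx j) (cy j) w')].

Lemma close_abs i j : close X Y i j ->
  [/\ X i - X j <= 2, X j - X i <= 2, Y i - Y j <= 2 & Y j - Y i <= 2].
Proof.
have sq (x y : R) : x * x + y * y <= 4%:~R -> x <= 2.
  move=> h; rewrite leNgt; apply/negP => lt.
  have y0 : 0 <= y * y by rewrite -expr2 sqr_ge0.
  have x0 : 0 < (x - 2) * (x + 2) by rewrite mulr_gt0; lra.
  by move: h; rewrite (_ : 4%:~R = 4 :> R) //; nra.
rewrite /close => h; split; [apply: sq h|apply: (sq _ (Y j - Y i))|
  apply: (sq _ (X i - X j))|apply: (sq _ (X j - X i))]; by move: h; congr (_ <= _); ring.
Qed.

Lemma abs_close i j : X i <= X j + 1 -> X j <= X i + 1 -> Y i <= Y j + 1 -> Y j <= Y i + 1 ->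
  close X Y i j.
Proof.
have sq (x y : R) : x <= y + 1 -> y <= x + 1 -> (x - y) * (x - y) <= 1.
  by move=> h1 h2; rewrite -expr2 -real_normK ?num_real // exprn_ile1 // ler_norml; lra.
move=> h1 h2 h3 h4; rewrite /close (_ : 4%:~R = 4 :> R) //.
have := sq _ _ h1 h2; have := sq _ _ h3 h4; lra.
Qed.

Lemma floor_same (x y : R) : Num.floor x = Num.floor y -> x <= y + 1.
Proof.
move=> E; have /andP[h1 _] := floor_itv y; have /andP[_] := floor_itv x.
by rewrite E intrD; lra.
Qed.

Lemma floor_near (x y : R) : x - y <= 2 -> Num.floor x - Num.floor y <= 2.
Proof.
move=> le; have /andP[h1 _] := floor_itv x; have /andP[_ h2] := floor_itv y.
rewrite lerBlDr -ltzD1 -(ltr_int R) !intrD; move: h2; rewrite intrD; lra.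
Qed.

Hypothesis N_big : (n * (k * 4) <= N)%N.

Let cx i := Num.floor (X i).
Let cy i := Num.floor (Y i).
Let key i w := block_key k (cx i) (cy i) w.

(** [g] is the content of the table and [z] the number of names issued. Bounding [z] by the number
    of columns processed is what keeps the identifiers below [n * (k * 4)]. *)
Record hash_inv (i w : nat) st : Prop := HashInv {
  hi_input : points_input st;
  hi_table : exists (g : int * int -> nat) (z : nat),
    [/\ ireg st 8 = z%:Z, (z <= i * (k * 4) + w)%N,
        forall e, htab st (0%N, e) = (g e)%:Z /\ (g e <= z)%N,
        forall e e', g e = g e' -> (0 < g e)%N -> e = e' &
        forall j w', (j < i)%N && (w' < k * 4)%N || (j == i) && (w' < w)%N ->
          iarr st (5%N, (j * (k * 4) + w')%N) = (g (key j w'))%:Z - 1 /\ (0 < g (key j w'))%N] }.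

Definition hash_regs i st : Prop :=
  [/\ ireg st 2 = i%:Z, ireg st 3 = cx i & ireg st 4 = cy i].

Lemma wp_hash_step i w st : (i < n)%N -> (w < k * 4)%N -> hash_inv i w st -> hash_regs i st ->
  wp N (hash_step k w) (ticks (hash_step k w))
    (fun st' => hash_inv i w.+1 st' /\ hash_regs i st') st.
Proof.
move=> im wk [hin [g [z [r8 zle hg inj hID]]]] [r2 r3 r4]; apply: wp_ticks => //.
apply: wp_seq; apply: wp_floor; apply: wp_seq; apply: wp_floor; apply: wp_seq; apply: wp_hload.
rewrite /= r3 r4 !floor_divz //.
rewrite -[(((cx i + _) %/ k)%Z, _)]/(key i w); set e := key i w.
set st1 := set_ireg _ 7 _.
have e1 : ireg st1 5 = e.1 by [].
have e2 : ireg st1 6 = e.2 by [].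
have [he gz] := hg e.
pose g' e' := if e' == e then (if g e == 0%N then z.+1 else g e) else g e'.
pose z' := if g e == 0%N then z.+1 else z.
have r7 : ireg st1 7 = (g e)%:Z by rewrite -he.
pose mid st2 := [/\ ireg st2 7 = (g' e)%:Z /\ ireg st2 8 = z'%:Z,
  forall e', htab st2 (0%N, e') = (g' e')%:Z, iarr st2 = iarr st, rarr st2 = rarr st &
  forall x, (x < 5)%N -> ireg st2 x = ireg st x].
apply: wp_seq; apply: (@wp_weaken _ _ _ _ _ mid).
- have test : beval st1 (BLeI (IReg 7) (IConst 0)) = (g e == 0%N).
    by rewrite -[LHS]/(ireg st1 7 <= 0) r7; lia.
  apply: wp_if; rewrite test => g0.
    apply: wp_seq; apply: wp_iset; apply: wp_seq; apply: wp_iset; apply: wp_hstore.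
    rewrite /mid /g' /z' g0 eqxx; split=> //=; try split; rewrite ?r8.
    + by lia.
    + by lia.
    + move=> e'; rewrite xpair_eqE /= -[X in e' == X]/(e.1, e.2) -surjective_pairing.
      by case: eqP => // _; [lia | case: (hg e')].
    + by move=> [|[|[|[|[|x]]]]].
  apply: wp_skip; move/negbTE in g0.
  rewrite /mid /g' /z' g0 eqxx; split=> //.
  + by move=> e'; case: eqP => [->//|_]; case: (hg e').
  + by move=> [|[|[|[|[|x]]]]].
- by [].
move=> st2 [[s7 s8] sh sA sR sr].
have g'0 : (0 < g' e)%N by rewrite /g' eqxx; case: ifP => //; lia.
have g'old e' : (0 < g e')%N -> g' e' = g e'.
  by move=> h; rewrite /g'; case: eqP => // E; rewrite -E ifN //; lia.
apply: (@wp_istore _ _ (i * (k * 4) + w)%N).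
- by rewrite /= sr // r2.
- by apply: leq_trans N_big; nia.
split; last by split=> /=; rewrite sr.
split.
  by case: hin => h1 h2 h3; split=> /= *; rewrite ?sr ?sR //; auto.
exists g', z'; split=> //=.
- by rewrite /z'; case: ifP => _; lia.
- by move=> e'; rewrite sh; split=> //; rewrite /g' /z'; have := hg e'; do 2!case: ifP; lia.
- have gle e' : (g e' < z.+1)%N by case: (hg e').
  move=> a b; rewrite /g'; case: (eqVneq a e) => [->|na]; case: (eqVneq b e) => [->|nb] //.
  + by case: ifP => [_ E|_]; [have := gle b; lia | apply: inj].
  + by case: ifP => [_ E|_]; [have := gle a; lia | apply: inj].
  + exact: inj.
- move=> j w' hjw; rewrite xpair_eqE /= s7 sA.
  have [|old] := boolP ((j == i) && (w' == w)).
    by case/andP => /eqP-> /eqP->; rewrite eqxx.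
  have w'k : (w' < k * 4)%N by lia.
  rewrite address_inj // (negbTE old).
  have [h1 h2] : iarr st (5%N, (j * (k * 4) + w')%N) = (g (key j w'))%:Z - 1 /\ (0 < g (key j w'))%N.
    by apply: hID; lia.
  by rewrite g'old.
Qed.

Lemma wp_hash_ids st : points_input st -> (forall e, htab st (0%N, e) = 0) -> ireg st 8 = 0 ->
  wp N (hash_ids k) ((ticks (hash_body k)).+2 * n.+1) identified st.
Proof.
move=> hin h0 r8.
apply: (wp_for (I := fun i => hash_inv i 0) (n := n)).
- by move=> i st1 [h _] _ _ /=; rewrite (pt_n h); lia.
- split; first by case: hin => *; split.
  exists (fun=> 0%N), 0%N; split=> // [e|j w']; last by lia.
  by split=> //; apply: h0.
- move=> i st1 [hin1 ht] im r2; apply: wp_ticks; first by apply: loop_free_unroll.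
  have iN : (i < N)%N by apply: leq_trans im _; apply: leq_trans N_big; nia.
  apply: wp_seq; apply: (@wp_rload _ _ i) => //; apply: wp_seq; apply: wp_floor.
  apply: wp_seq; apply: (@wp_rload _ _ i) => //; apply: wp_seq; apply: wp_floor.
  apply: wp_weaken (wp_unroll (I := fun w st' => hash_inv i w st' /\ hash_regs i st')
     (T := fun w => ticks (hash_step k w)) _ _) (leqnn _) _.
  + split; first by split=> //; case: hin1 => *; split.
    by split=> //=; rewrite ?(pt_x hin1) ?(pt_y hin1).
  + by move=> w st2 wk [h1 h2]; apply: wp_hash_step.
  + move=> st2 [[h1 [g [z [g1 g2 g3 g4 g5]]]] [h2 _ _]]; split=> //; split.
      by case: h1 => *; split.
    exists g, z; split=> //; first by lia.
    by move=> j w' hj; apply: g5; lia.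
- move=> st1 [h1 [g [z [g1 g2 g3 g4 g5]]]] _.
  have hID i w : (i < n)%N -> (w < k * 4)%N ->
      iarr st1 (5%N, (i * (k * 4) + w)%N) = (g (key i w))%:Z - 1 /\ (0 < g (key i w))%N.
    by move=> im wk; apply: g5; rewrite im wk.
  exists cx, cy, (fun i w => (g (key i w)).-1); split.
  + case: h1 => *; split=> // i w im wk; have [-> ] := hID i w im wk; lia.
  + by move=> i w im wk; have [_] := hID i w im wk; have [_] := g3 (key i w); lia.
  + by move=> i j _ _ Ex Ey; apply: abs_close; apply: floor_same.
  + move=> i j _ _ /close_abs[*]; split; exact: floor_near.
  + move=> i j w w' im jn wk wk'; split=> [E|E]; last by rewrite /key E.
    have [_ p1] := hID i w im wk; have [_ p2] := hID j w' jn wk'.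
    by apply: g4 => //; rewrite -(prednK p1) -(prednK p2) E.
Qed.

(** * Block names without floor and hashing *)

Section PlainIdentifiers.
Variables Cx Cy : nat -> nat.
Hypothesis Cx_lt : forall i, (i < n)%N -> (Cx i < n)%N.
Hypothesis Cy_lt : forall i, (i < n)%N -> (Cy i < n)%N.
Let W : nat := (n + (k + 3))%N.
Let val (i w : nat) : nat := ((Cx i + offset_x w) %/ k * W + (Cy i + offset_y w) %/ k)%N.

Lemma offset_lt w : (w < k * 4)%N -> (offset_x w < k + 3)%N /\ (offset_y w < k + 3)%N.
Proof.
rewrite /offset_x /offset_y => wk; have : (w %/ 4 < k)%N by rewrite ltn_divLR.
by lia.
Qed.

(** Both second digits stay below the radix [W], so equal values have equal digits. *)
Lemma val_key i j w w' : (i < n)%N -> (j < n)%N -> (w < k * 4)%N -> (w' < k * 4)%N ->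
  (val i w = val j w' <->
   block_key k (Cx i)%:Z (Cy i)%:Z w = block_key k (Cx j)%:Z (Cy j)%:Z w').
Proof.
move=> im jn wk wk'; have [ox oy] := offset_lt wk; have [ox' oy'] := offset_lt wk'.
have dle (a : nat) : (a %/ k <= a)%N by exact: leq_div.
have b1 : ((Cy i + offset_y w) %/ k < W)%N.
  by apply: leq_ltn_trans (dle _) _; have := Cy_lt im; rewrite /W; lia.
have b2 : ((Cy j + offset_y w') %/ k < W)%N.
  by apply: leq_ltn_trans (dle _) _; have := Cy_lt jn; rewrite /W; lia.
rewrite /block_key -!PoszD !divz_nat; split.
  by rewrite /val => /eqP; rewrite address_inj // => /andP[/eqP-> /eqP->].
by rewrite /val => -[-> ->].
Qed.

Hypothesis table_N : (n + (k + 3) <= N)%N.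

Lemma wp_div_table st : ireg st 0 = n%:Z ->
  wp N (div_table k) (2 + 9 * (n + (k + 3)).+1) (fun st' =>
    forall j, (j < n + (k + 3))%N -> iarr st' (6%N, j) = (j %/ k)%N%:Z) st.
Proof.
move=> r0; apply: (wp_seq (T1 := 1) (T2 := (1 + 9 * (n + (k + 3)).+1)%N)); apply: wp_iset.
apply: wp_seq; apply: wp_iset.
apply: (wp_for (T := 7) (n := (n + (k + 3))%N) (I := fun i st' =>
  [/\ ireg st' 0 = n%:Z, ireg st' 3 = (i %/ k)%N%:Z, ireg st' 4 = (i %% k)%N%:Z &
      forall j, (j < i)%N -> iarr st' (6%N, j) = (j %/ k)%N%:Z])).
- by move=> i st1 [s0 _ _ _] _ _ /=; rewrite s0; lia.
- by split=> //=; rewrite ?div0n ?mod0n.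
- move=> i st1 [s0 s3 s4 hj] im r2.
  have iN := leq_trans im table_N.
  apply: (@wp_weaken _ _ _ (1 + (1 + (maxn (1 + 1) 1).+1))) => //.
  2: by move=> st2; apply.
  apply: wp_seq; apply: (@wp_istore _ _ i) => //; apply: wp_seq; apply: wp_iset.
  have tab j : (j < i.+1)%N -> (if (6%N, j) == (6%N, i) then ireg st1 3 else iarr st1 (6%N, j))
      = (j %/ k)%N%:Z.
    by rewrite xpair_eqE /= s3; case: eqP => [->//|ne] lt; apply: hj; lia.
  have := divn_eq i k; have := ltn_pmod i k_gt0; set a := (i %/ k)%N; set b := (i %% k)%N => bk Ei.
  have next c d : i.+1 = (c * k + d)%N -> (d < k)%N -> (i.+1 %/ k)%N = c /\ (i.+1 %% k)%N = d.
    by move=> -> dk; rewrite divnMDl // divn_small // addn0 modnMDl modn_small.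
  apply: wp_if => /=; rewrite s4 => h.
    have [Ed Em] := next a.+1 0%N ltac:(nia) k_gt0.
    apply: wp_seq; apply: wp_iset; apply: wp_iset; split=> //.
    by split=> //=; rewrite ?Ed ?Em ?s3 //; lia.
  have [Ed Em] := next a b.+1 ltac:(nia) ltac:(lia).
  apply: wp_skip; split=> //; split=> //=; rewrite ?Ed ?Em ?s3 ?s4 //; lia.
- by move=> st1 [].
Qed.

Record key_inv (i w : nat) st : Prop := KeyInv {
  ki_n : ireg st 0 = n%:Z;
  ki_x j : (j < n)%N -> iarr st (3%N, j) = (Cx j)%:Z;
  ki_y j : (j < n)%N -> iarr st (4%N, j) = (Cy j)%:Z;
  ki_table j : (j < n + (k + 3))%N -> iarr st (6%N, j) = (j %/ k)%N%:Z;
  ki_key j w' : (j < i)%N && (w' < k * 4)%N || (j == i) && (w' < w)%N ->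
    rarr st (2%N, (j * (k * 4) + w')%N) = (val j w')%:Z%:~R }.

Lemma wp_key_loop st : key_inv 0 0 st ->
  wp N (key_loop k) ((ticks (key_body k)).+2 * n.+1) (key_inv n 0) st.
Proof.
move=> h0; apply: (wp_for (I := fun i => key_inv i 0) (n := n)).
- by move=> i st1 [h _ _ _ _] _ _ /=; rewrite h; lia.
- by case: h0 => *; split=> //= j w'; lia.
- move=> i st1 hi im r2; apply: wp_ticks; first by apply: loop_free_unroll.
  have iN : (i < N)%N by apply: leq_trans im _; apply: leq_trans N_big; nia.
  apply: wp_seq; apply: (@wp_iload _ _ i) => //; apply: wp_seq; apply: (@wp_iload _ _ i) => //.
  rewrite (ki_x hi) // [iarr (set_ireg _ _ _) _](ki_y hi) //.
  apply: wp_weaken (wp_unroll (I := fun w st' => key_inv i w st' /\ [/\ ireg st' 2 = i%:Z,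
     ireg st' 3 = (Cx i)%:Z & ireg st' 4 = (Cy i)%:Z])
     (T := fun w => ticks (key_step k w)) _ _) (leqnn _) _.
  + by split; [case: hi => *; split | split].
  + move=> w st2 wk [[s0 sx sy sT sk] [s2 s3 s4]]; apply: wp_ticks => //.
    have [ox oy] := offset_lt wk; have cx_n := Cx_lt im; have cy_n := Cy_lt im.
    have jx : (Cx i + offset_x w < n + (k + 3))%N by lia.
    have jy : (Cy i + offset_y w < n + (k + 3))%N by lia.
    apply: wp_seq; apply: (@wp_iload _ _ (Cx i + offset_x w)%N).
    * by rewrite /= s3.
    * exact: leq_trans jx table_N.
    apply: wp_seq; apply: (@wp_iload _ _ (Cy i + offset_y w)%N).
    * by rewrite /= s4.
    * exact: leq_trans jy table_N.
    apply: (@wp_rstore _ _ (i * (k * 4) + w)%N).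
    * by rewrite /= s2.
    * by apply: leq_trans N_big; nia.
    split=> //; split=> // j w' hj; rewrite /= xpair_eqE /= !sT // s0.
    have w'k : (w' < k * 4)%N by lia.
    rewrite address_inj //; case: ifP => [/andP[/eqP-> /eqP->]|ne].
      by rewrite /val /W !(PoszD, PoszM).
    by apply: sk; move: ne hj; lia.
  + move=> st2 [[g1 g2 g3 g4 g5] [h2 _ _]]; split=> //; split=> // j w' hj.
    by apply: g5; lia.
- by [].
Qed.

End PlainIdentifiers.

Definition plain_cost : nat :=
  ((cluster_cost 0 0 1 + cluster_cost 1 1 1 + cluster_cost 2 2 0 + ticks (key_body k)) * (k * 4).+1
  + 9 * k + 50)%N.

(** The third clustering determines the memory and the logarithm: its tree over [n * (k * 4)] keys
    has twice that many nodes. *)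
Lemma wp_plain_ids st : (2 * (n * (k * 4)) + n + k + 5 <= N)%N -> points_input st ->
  wp N (plain_ids k) (plain_cost * (n.+1 * (trunc_log 2 (n * (k * 4)).*2).+1)) identified st.
Proof.
move=> NN hin; set q := (k * 4)%N in NN *.
have q0 : (0 < q)%N by rewrite /q muln_gt0 k_gt0.
have nq : (n <= n * q)%N by rewrite leq_pmulr.
have mN : (n.*2.+2 <= N)%N by lia.
have mqN : ((n * q).*2.+2 <= N)%N by lia.
have tN : (n + (k + 3) <= N)%N by lia.
set g := trunc_log 2 (n * q).*2; set g1 := trunc_log 2 n.*2.
have gg : (g1 <= g)%N by rewrite leq_trunc_log // leq_double.
set c0 := cluster_cost 0 0 1; set c1 := cluster_cost 1 1 1; set c2 := cluster_cost 2 2 0.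
set kb := ticks (key_body k).
apply: (@wp_weaken _ _ _ (1 + (c0 * (n.+1 * g1.+1) + (c1 * (n.+1 * g1.+1) +
   ((2 + 9 * (n + (k + 3)).+1) + (kb.+2 * n.+1 + (1 + c2 * ((n * q).+1 * g.+1))))))) _ identified).
apply: wp_seq; apply: wp_iset; set st1 := set_ireg _ _ _.
have in1 : points_input st1 by case: hin => *; split.
have n1 : ireg st1 1 = n%:Z by exact: (pt_n hin).
have ci1 : cluster_input n 0 X st1 by split=> // i im; rewrite (pt_x in1).
apply: wp_seq; apply: wp_frame; apply: wp_weaken (wp_cluster mN 0 (tau := 1) _ ci1) (leqnn _) _ => //.
move=> st2 [Cx [hx Cx_lt x_same x_gap]] F2.
have ci2 : cluster_input n 1 Y st2.
  by split=> [|i im]; rewrite ?(frame_ireg F2) ?(frame_rarr F2) // (pt_y in1).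
apply: wp_seq; apply: wp_frame; apply: wp_weaken (wp_cluster mN 1 (tau := 1) _ ci2) (leqnn _) _ => //.
move=> st3 [Cy [hy Cy_lt y_same y_gap]] F3.
have n3 : ireg st3 0 = n%:Z by rewrite (frame_ireg F3) // (frame_ireg F2) // (pt_n in1).
apply: wp_seq; apply: wp_frame; apply: wp_weaken (wp_div_table tN n3) (leqnn _) _.
move=> st4 ht F4.
have k4 : key_inv Cx Cy 0 0 st4.
  split=> //.
  - by rewrite (frame_ireg F4).
  - by move=> j jn; rewrite (frame_iarr F4) // (frame_iarr F3) // hx.
  - by move=> j jn; rewrite (frame_iarr F4) // hy.
  - by move=> j w'; lia.
apply: wp_seq; apply: wp_frame; apply: wp_weaken (wp_key_loop Cx_lt Cy_lt tN k4) (leqnn _) _.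
move=> st5 [n5 _ _ _ hk] F5.
have wrF x : (x != 2)%N -> ~~ writes_rarr (key_loop k) x.
  move=> x2; rewrite /key_loop /for_loop /key_body.
  have: ~~ writes_rarr (unroll (k * 4) (key_step k)) x.
    by apply: writes_unrollF => w /=; rewrite (negbTE x2).
  by set U := unroll _ _; clearbody U => wU; rewrite /= (negbTE wU).
have in5 : points_input st5.
  split=> // i im; rewrite (frame_rarr F5) ?wrF // (frame_rarr F4) // (frame_rarr F3) //
    (frame_rarr F2) //; [exact: (pt_x in1) | exact: (pt_y in1)].
apply: wp_seq; apply: wp_iset; set st6 := set_ireg _ _ _.
pose K u : R := rarr st5 (2%N, u).
have ci6 : cluster_input (n * q) 2 K st6.
  by split=> //; rewrite /st6 /= n5.
apply: wp_frame; apply: wp_weaken (wp_cluster mqN 2 (tau := 0) _ ci6) (leqnn _) _ => //.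
- move=> st7 [C [hC C_lt c_same c_gap]] F7.
  have u_lt i w : (i < n)%N -> (w < q)%N -> (i * q + w < n * q)%N by nia.
  exists (fun i => (Cx i)%:Z), (fun i => (Cy i)%:Z), (fun i w => C (i * q + w)%N); split.
  + split; first by rewrite (frame_ireg F7).
    * by move=> i w im wk; rewrite hC // u_lt.
    * by move=> i im; rewrite (frame_rarr F7) // (pt_x in5).
    * by move=> i im; rewrite (frame_rarr F7) // (pt_y in5).
  + by move=> i w im wk; apply: C_lt; apply: u_lt.
  + move=> i j im jn [Ex] [Ey]; apply: abs_close;
      [apply: x_same|apply: x_same|apply: y_same|apply: y_same] => //.
  + move=> i j im jn /close_abs[h1 h2 h3 h4].
    (* Threshold 1, gap property with [d = 2]: numbers more than 2 apart would put the coordinates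
       more than 2 apart. *)
    have gap (K' : nat -> R) (C' : nat -> nat) a b : K' b - K' a <= 2 ->
        ((C' a + 2 < C' b)%N -> K' a + 1%:~R *+ 2 < K' b) -> (C' b)%:Z - (C' a)%:Z <= 2.
      move=> h hg; rewrite leNgt; apply/negP => lt.
      by have := hg ltac:(lia); rewrite -mulr_natr mul1r; lra.
    by split; [apply: (gap X)|apply: (gap X)|apply: (gap Y)|apply: (gap Y)] => //;
      [apply: x_gap|apply: x_gap|apply: y_gap|apply: y_gap].
  + move=> i j w w' im jn wk wk'; rewrite -(val_key Cx Cy_lt im jn wk wk').
    have ui := u_lt i w im wk; have uj := u_lt j w' jn wk'.
    have Ki : K (i * q + w)%N = _ := hk i w ltac:(rewrite im wk //).
    have Kj : K (j * q + w')%N = _ := hk j w' ltac:(rewrite jn wk' //).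
    split=> [E|E].
      have l1 := c_same _ _ ui uj E; have l2 := c_same _ _ uj ui (esym E).
      have : K (i * q + w)%N = K (j * q + w')%N by apply/eqP; rewrite eq_le; lra.
      by rewrite Ki Kj => /intr_inj[].
    have EK : K (i * q + w)%N = K (j * q + w')%N by rewrite Ki Kj E.
    (* Threshold 0, gap property with [d = 0]: different numbers would make the keys different. *)
    have [lt|lt|//] := ltngtP (C (i * q + w)%N) (C (j * q + w')%N).
    * have := c_gap (i * q + w)%N (j * q + w')%N 0%N ui uj; rewrite addn0 => /(_ lt).
      by rewrite EK mulr0n addr0 ltxx.
    * have := c_gap (j * q + w')%N (i * q + w)%N 0%N uj ui; rewrite addn0 => /(_ lt).
      by rewrite EK mulr0n addr0 ltxx.
- rewrite /plain_cost -/q -/c0 -/c1 -/c2 -/kb; clearbody c0 c1 c2 kb g g1.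
  (* Each summand is bounded by a multiple of [G]; the products are then generalised, which leaves a
     linear goal. *)
  have e1 : (n.+1 * g1.+1 <= n.+1 * g.+1)%N by rewrite leq_mul2l ltnS gg.
  have e2 : ((n * q).+1 <= q.+1 * n.+1)%N by nia.
  have e3 : ((n * q).+1 * g.+1 <= q.+1 * (n.+1 * g.+1))%N by rewrite mulnA leq_mul2r e2 orbT.
  have e4 : (n.+1 <= n.+1 * g.+1)%N by rewrite leq_pmulr.
  set G := (n.+1 * g.+1)%N in e1 e3 e4 *.
  have e5 : (G <= q.+1 * G)%N by rewrite leq_pmull.
  have scale c x : (x <= q.+1 * G)%N -> (c * x <= c * q.+1 * G)%N.
    by move=> le; rewrite -mulnA leq_mul2l le orbT.
  have s0 := scale c0 _ (leq_trans e1 e5); have s1 := scale c1 _ (leq_trans e1 e5).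
  have s2 := scale c2 _ e3; have s3 := scale kb _ (leq_trans e4 e5).
  have e6 : (9 * k <= 9 * k * G)%N by rewrite leq_pmulr // muln_gt0.
  rewrite (_ : 9 * (n + (k + 3)).+1 = 9 * n.+1 + 9 * k + 27)%N; last by lia.
  set k9 := (9 * k)%N in e6 *; clearbody k9.
  rewrite !mulnDl -[kb.+2]addn2 mulnDl; move: s0 s1 s2 s3 e4 e6.
  move: (c0 * _)%N (c1 * (n.+1 * _))%N (c2 * (_.+1 * _))%N (kb * n.+1)%N
    (c0 * q.+1 * G)%N (c1 * q.+1 * G)%N (c2 * q.+1 * G)%N (kb * q.+1 * G)%N (k9 * G)%N.
  by move=> x0 x1 x2 x3 y0 y1 y2 y3 y4; lia.
- by [].
Qed.

End Identifiers.

(** * The approximation ratio and the running time *)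

Section Ratio.
Variables (R : realType) (K : nat).
Hypothesis K_gt0 : (0 < K)%N.

(** The factor 12 matches the excess in [sum_size_shift_ids], so that the average overlap is at most
    [1 + 1 / K]. *)
Definition period : nat := (12 * K)%N.
(** [K + 1] times the number of cells of an enlarged block, the least value allowed by the size
    threshold [M_big]. *)
Definition capacity : nat := (K.+1 * ((period + 2) * (period + 2)))%N.
Definition solver : program := all_shifts capacity (period * 4) period.
Definition solver_cost : nat := all_shifts_cost (period * 4) capacity period.

Lemma wp_solver N n X Y (st : state R) : (n * (period * 4) * capacity <= N)%N ->
  identified n period X Y st ->
  wp N solver (solver_cost * n.+1) (fun st' => exists V : pred nat,
    [/\ covers (close X Y) (iota 0 n) V,
        forall j, (j < n)%N -> iarr st' (0%N, j) = (V j : nat)%:Z &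
        forall W : pred nat, covers (close X Y) (iota 0 n) W ->
          (K * K * count V (iota 0 n) <= K.+1 * K.+1 * count W (iota 0 n))%N]) st.
Proof.
move=> N_big [cx [cy [ID [hin ID_lt same near IDP]]]].
have k2 : (2 <= period)%N by rewrite /period; lia.
have M0 : (0 < capacity)%N by rewrite /capacity; nia.
have q0 : (0 < period * 4)%N by lia.
set sc := fun s => shift_cover (close X Y) n capacity (shift_ids ID s).
have cov s : (s < period)%N -> covers (close X Y) (iota 0 n) (sc s).
  move=> sk; apply: shift_cover_covers; first exact: close_sym.
  by move=> i j im jn _; apply: (close_common_block k2 near IDP).
apply: wp_weaken (wp_all_shifts M0 q0 N_big ID_lt (leqnn _) cov hin) (leqnn _) _.
move=> st' [_ [V [cV hV _ best]]]; exists V; split=> // W cW.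
have cnt (U : pred nat) : count U (iota 0 n) = (\sum_(i < n) U i)%N.
  by rewrite -sum1_count -(big_mkord xpredT (fun i => nat_of_bool (U i)))
    /index_iota subn0 [in LHS]big_mkcond.
pose sz s i := size (undup (shift_ids ID s i)).
have one s : (s < period)%N ->
    (K * count V (iota 0 n) <= K.+1 * \sum_(i < n) W i * sz s i)%N.
  move=> sk; apply: (@leq_trans (K * count (sc s) (iota 0 n))%N).
    by rewrite leq_mul2l best ?orbT.
  apply: shift_cover_size => //.
  - by move=> i b im; apply: (shift_ids_lt ID_lt) => //; lia.
  - exact: leqnn.
  - by move=> b; apply: (block_uncovered k2 same IDP).
(* The kept cover is no larger than that of any shift, so the bounds for the single shifts may be
   added. *)
have total : (period * (K * count V (iota 0 n)) <=
    K.+1 * \sum_(s < period) \sum_(i < n) W i * sz s i)%N.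
  rewrite big_distrr /= -{1}[period]card_ord -sum_nat_const.
  by apply: leq_sum => s _; apply: one.
(* After exchanging the sums, a point of [W] pays at most [period + 12] over all shifts, that is
   [(K + 1) / K] per shift. *)
have few : (\sum_(s < period) \sum_(i < n) W i * sz s i <=
    (period + 12) * count W (iota 0 n))%N.
  rewrite exchange_big cnt big_distrr /=; apply: leq_sum => i _.
  by rewrite -big_distrr [leqRHS]mulnC leq_mul2l (sum_size_shift_ids k2 IDP) ?orbT.
by move: total few; rewrite /period; nia.
Qed.

End Ratio.

Lemma period_gt0 K : (0 < K)%N -> (0 < period K)%N.
Proof. by rewrite /period; lia. Qed.

(** * From indices to points and from [K] to [eps] *)

Section Correctness.
Variables (R : realType) (eps : R) (K : nat).
Hypothesis K_gt0 : (0 < K)%N.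
Hypothesis K_eps : 3 <= eps * K%:R.

(** [(K + 1) ^ 2 <= K ^ 2 + 3 K <= (1 + eps) K ^ 2], the first step because [K >= 1]. *)
Lemma ratio_bound a b : (K * K * a <= K.+1 * K.+1 * b)%N -> a%:R <= (1 + eps) * b%:R :> R.
Proof.
rewrite -(ler_nat R) !natrM -[K.+1]addn1 natrD => h.
have K1 : 1 <= K%:R :> R by rewrite ler1n.
have b0 : 0 <= b%:R :> R by [].
have KK : 0 < K%:R * K%:R :> R by rewrite mulr_gt0 // ltr0n.
rewrite -(ler_pM2l KK); apply: le_trans h _.
rewrite mulrA; apply: ler_wpM2r => //.
have h2 : 0 <= K%:R * (eps * K%:R - 3) by rewrite mulr_ge0 ?subr_ge0.
by move: K1 h2; set k := K%:R; nra.
Qed.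

Lemma close_dist (s : seq (point R)) i j :
  close (fun i => (nth (0, 0) s i).1) (fun i => (nth (0, 0) s i).2) i j =
  (dist (nth (0, 0) s i) (nth (0, 0) s j) <= 2).
Proof.
rewrite /close /dist -!expr2; set x := _ + _.
have x0 : 0 <= x by rewrite addr_ge0 ?sqr_ge0.
have -> : 2 = Num.sqrt (4%:~R) :> R.
  by rewrite (_ : 4%:~R = 2 ^+ 2) ?sqrtr_sqr ?normr_nat //; ring.
by rewrite ler_sqrt.
Qed.

(** [T n] bounds the time and is also the number of cells per array, hence a separate condition for
    the memory. Any naming program [pre] may be plugged in. *)
Lemma approximates pre (T : nat -> nat) :
  (forall N n X Y (st : state R), (T n <= N)%N -> points_input n X Y st ->
     (forall e, htab st (0%N, e) = 0) -> ireg st 8 = 0 ->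
     exists Tp, wp N pre Tp (identified n (period K) X Y) st /\
       (Tp + solver_cost K * n.+1 <= T n)%N) ->
  (forall n, (n * (period K * 4) * capacity K <= T n)%N) ->
  approximates_vertex_cover eps (Seq pre (solver K)) T.
Proof.
move=> hpre memT P s sP.
have uP : uniq P by apply: fset_uniq.
have us : uniq s by rewrite (perm_uniq sP).
have sz : #|` P| = size s by rewrite (perm_size sP).
have memP p : (p \in s) = (p \in P) by rewrite (perm_mem sP).
rewrite sz; set n := size s; set N := T n.
pose X i := (nth (0, 0) s i).1; pose Y i := (nth (0, 0) s i).2.
have hin : points_input n X Y (init s) by split.
have [Tp [w le]] := hpre N n X Y (init s) (leqnn _) hin (fun _ => erefl) erefl.
have [t [st [ex tN [V [cV hV best]]]]] : wp N (Seq pre (solver K)) (T n)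
    (fun st' => exists V : pred nat,
    [/\ covers (close X Y) (iota 0 n) V,
        forall j, (j < n)%N -> iarr st' (0%N, j) = (V j : nat)%:Z &
        forall W : pred nat, covers (close X Y) (iota 0 n) W ->
          (K * K * count V (iota 0 n) <= K.+1 * K.+1 * count W (iota 0 n))%N]) (init s).
  apply: wp_weaken _ le (fun _ => id).
  apply: wp_seq; apply: wp_weaken w (leqnn _) _ => st1; apply: wp_solver => //.
exists st; first by exists t.
have outE p : (p \in output s st) = (p \in s) && V (index p s).
  rewrite in_fset /= inE /=; case: (boolP (p \in s)) => //= ps.
  by rewrite hV ?index_mem //; case: (V _).
have closeE p q : p \in s -> q \in s -> close X Y (index p s) (index q s) = (dist p q <= 2).
  by move=> ps qs; rewrite close_dist !nth_index.
have countE (U : pred (point R)) : count U s = count (fun i => U (nth (0, 0) s i)) (iota 0 n).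
  by rewrite -[in LHS](mkseq_nth (0, 0) s) count_map.
split.
  split; first by apply/fsubsetP => p; rewrite outE memP => /andP[].
  move=> p q pP qP /andP[pq d]; rewrite -!memP in pP qP.
  have ne : index p s != index q s.
    by apply: contraNneq pq => E; rewrite -(nth_index (0, 0) pP) E nth_index.
  have := cV (index p s) (index q s); rewrite !mem_iota !index_mem pP qP => /(_ isT isT ne).
  by rewrite closeE // !outE pP qP => /(_ d).
move=> OPT [[/fsubsetP subP covP] _].
pose W : pred nat := fun i => nth (0, 0) s i \in OPT.
have cW : covers (close X Y) (iota 0 n) W.
  move=> i j; rewrite !mem_iota !add0n /= => im jn ne cij.
  apply: covP; rewrite -?memP ?mem_nth //.
  by rewrite /adjacent nth_uniq // ne -close_dist.
apply: ratio_bound; apply: (@leq_trans (K * K * count V (iota 0 n))%N).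
  rewrite leq_mul2l; apply/orP; right.
  have -> : count V (iota 0 n) = size [seq p <- s | V (index p s)].
    rewrite size_filter countE; apply: eq_in_count => i; rewrite mem_iota add0n => /= im.
    by rewrite index_uniq.
  by apply: uniq_leq_size (fset_uniq _) _ => p; rewrite mem_filter outE andbC.
apply: leq_trans (best W cW) _; rewrite leq_mul2l; apply/orP; right.
rewrite -(countE (mem OPT)) -size_filter.
by apply: uniq_leq_size => [|p]; rewrite ?filter_uniq // mem_filter => /andP[].
Qed.

End Correctness.

(** The crude estimate [c < 2 ^ c] is enough, as [c] does not grow with [n] in the application. *)
Lemma trunc_log_mul n c : (0 < n)%N -> (trunc_log 2 (n * c) <= trunc_log 2 n + c)%N.
Proof.
move=> n0; case: c => [|c]; first by rewrite muln0.
have h1 := trunc_log_ltn n (isT : (1 < 2)%N).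
have h2 : (c.+1 <= 2 ^ c)%N by exact: ltn_expl.
have h3 : (2 ^ trunc_log 2 (n * c.+1) <= n * c.+1)%N.
  by apply: trunc_logP => //; rewrite muln_gt0 n0.
have : (2 ^ trunc_log 2 (n * c.+1) < 2 ^ ((trunc_log 2 n).+1 + c))%N.
  apply: leq_ltn_trans h3 _; rewrite expnD.
  by apply: leq_trans _ (leq_mul h1 h2); rewrite ltn_pmul2r.
by rewrite ltn_exp2l //; lia.
Qed.

Lemma plain_unroll m f : (forall i, plain (f i)) -> plain (unroll m f).
Proof. by move=> h; rewrite /unroll; elim: (iota 0 m) => //= i l ->; rewrite h. Qed.

Lemma plain_chain (A : Type) b f (l : seq A) : (forall a, plain (f a)) -> plain (chain b f l).
Proof. by move=> h; elim: l => //= a l ->; rewrite h. Qed.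

Lemma plain_solver K : plain (solver K).
Proof.
rewrite /solver /all_shifts /=; apply: plain_unroll => s.
rewrite /one_shift /shift_pass /insert_loop /solve_loop /for_loop.
have: plain (unroll 4 (solve_step (capacity K) (period K * 4) s)).
  apply: plain_unroll => c /=; apply: plain_chain => m /=; apply/andP; split.
    exact: plain_unroll.
  by apply: plain_chain => a; apply: plain_unroll => x; case: ifP.
by set U := unroll 4 (solve_step _ _ _); clearbody U => /= ->.
Qed.

Lemma plain_plain_ids k : plain (plain_ids k).
Proof. by rewrite /plain_ids /key_loop /key_body /= plain_unroll. Qed.

Unset Implicit Arguments.
Theorem theorem6 (R : realType) (eps : R) (heps : 0 < eps) :
  (exists (c : program) (T : nat -> nat),
      bigO T (fun n : nat => n) /\
      approximates_vertex_cover eps c T) /\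
  (exists (c : program) (T : nat -> nat),
      plain c /\
      bigO T (fun n : nat => (n * trunc_log 2 n)%N) /\
      approximates_vertex_cover eps c T).
Proof.
have [K K0 K_eps] : exists2 K, (0 < K)%N & 3 <= eps * K%:R.
  exists (Num.bound (3 / eps)).+1 => //.
  have h : 3 / eps < (Num.bound (3 / eps))%:R by apply: archi_boundP; rewrite divr_ge0 // ltW.
  move: h; rewrite ltr_pdivrMr // mulrC => h; apply: le_trans (ltW h) _.
  by rewrite ler_wpM2l ?ler_nat // ltW.
have k0 := period_gt0 K0; set q := (period K * 4)%N.
have q0 : (0 < q)%N by rewrite /q; lia.
have M0 : (0 < capacity K)%N by rewrite /capacity !muln_gt0 addn2.
split.
(* The last summand pays for the memory. The factor [n.+1] instead of [n] leaves time for the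
   constant overhead on the empty input. *)
- pose C := ((ticks (hash_body (period K))).+2 + solver_cost K + q * capacity K)%N.
  exists (Seq (hash_ids (period K)) (solver K)), (fun n => C * n.+1)%N; split.
    by exists (C * 2)%N, 1%N => n n1; nia.
  apply: (approximates K0 K_eps) => // [N n X Y st TN hin h0 r8|n]; last first.
    by rewrite -mulnA mulnC -/q; apply: leq_mul => //; rewrite /C; lia.
  exists ((ticks (hash_body (period K))).+2 * n.+1)%N; split.
    apply: wp_hash_ids => //; apply: leq_trans TN; rewrite -/q mulnC.
    have : (q <= q * capacity K)%N by rewrite leq_pmulr.
    by move=> h; apply: leq_mul => //; rewrite /C; lia.
  by rewrite -mulnDl leq_mul2r /C leq_addr orbT.
- pose g n := (n.+1 * (trunc_log 2 (n * q).*2).+1)%N.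
  pose C := (plain_cost (period K) + solver_cost K + q * capacity K * 3 + period K + 6)%N.
  have g1 n : (n.+1 <= g n)%N by rewrite leq_pmulr.
  exists (Seq (plain_ids (period K)) (solver K)), (fun n => C * g n)%N; split.
    by apply/andP; split; [exact: plain_plain_ids | exact: plain_solver].
  split.
    (* From [n = 2] on the logarithm [l] is positive, so [n + 1 <= 2 n] and
       [l + 2 q + 1 <= (2 q + 2) l]; at [n = 1] the claimed bound would be 0. *)
    exists (C * (2 * (q.*2 + 2)))%N, 2%N => n n2; rewrite -mulnA leq_mul2l; apply/orP; right.
    have lg : (0 < trunc_log 2 n)%N by rewrite trunc_log_gt0.
    have := @trunc_log_mul n q.*2; rewrite -doubleMr => /(_ (ltnW n2)) le.
    rewrite /g; set l := trunc_log 2 n in lg le *; move: (trunc_log 2 _) le => l' le.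
    apply: (@leq_trans (2 * n * ((q.*2 + 2) * l))%N); last by nia.
    by apply: leq_mul; [lia | nia].
  have qM : (q <= q * capacity K)%N by rewrite leq_pmulr.
  apply: (approximates K0 K_eps) => // [N n X Y st TN hin h0 r8|n]; last first.
    rewrite -mulnA mulnC -/q; apply: leq_mul; first by rewrite /C; lia.
    by apply: leq_trans (g1 n).
  exists (plain_cost (period K) * g n)%N; split.
    have mem : (2 * (n * q) + n + period K + 5 <= C * g n)%N.
      apply: (@leq_trans (C * n.+1)%N); last by rewrite leq_mul2l g1 orbT.
      rewrite /C; move: (plain_cost _) (solver_cost _) (q * _)%N qM => a b c qc; nia.
    apply: wp_plain_ids => //; first by apply: leq_trans TN; apply: leq_trans mem; rewrite -/q; lia.
    exact: leq_trans mem TN.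
  rewrite /C; move: (plain_cost _) (solver_cost _) => a b.
  rewrite -!addnA mulnDl leq_add2l mulnDl; apply: leq_trans _ (leq_addr _ _).
  by rewrite leq_mul2l g1 orbT.
Qed.
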